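(* Let $d\geq 2$, let $P:\mathbb{R}^d\to\mathbb{R}$ be a quadratic polynomial with integral coefficients, let $Z=Z_P=\{\mathbf{x}\in\mathbb{R}^d: P(\mathbf{x})=0\}$, and let $Z_{\mathrm{reg}}=\{\mathbf{x}\in Z:\nabla P(\mathbf{x})\neq \mathbf{0}\}$. Let $\mu$ be a measure on $\mathbb{R}^{d-1}$ which is absolutely $\alpha$-friendly and Ahlfors $\delta$-regular, let $U\subset\mathbb{R}^{d-1}$ be an open set containing $\mathrm{Supp}(\mu)$, let $\Psi:U\to Z_{\mathrm{reg}}$ be a local coordinate chart, and let $\nu:=\Psi[\mu]$ be the pushforward of $\mu$ under $\Psi$. Then for every $c\geq 1$, \[ \dim_H\big(W_{c,Z}\cap \mathrm{Supp}(\nu)\big)\leq \delta-\alpha\Big(1-\frac1c\Big), \] where $\dim_H$ denotes Hausdorff dimension.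
   Context: Rational points are written $\frac{\mathbf{p}}{q}$ with $\mathbf{p}\in\mathbb{Z}^d$ primitive and $q$ a positive integer; $\|\cdot\|$ is the max norm. For $\mathbf{x}\in Z$, define $\omega_Z(\mathbf{x})=\sup\{c>0: \exists C=C(\mathbf{x})>0 \text{ and infinitely many } \frac{\mathbf{p}}{q}\in Z\cap\mathbb{Q}^d \text{ with } \|\mathbf{x}-\frac{\mathbf{p}}{q}\|\leq C q^{-c}\}$, and $W_{c,Z}=\{\mathbf{x}\in Z:\omega_Z(\mathbf{x})>c\}$. A locally finite Borel measure $\mu$ on $\mathbb{R}^k$ is absolutely $\alpha$-decaying ($\alpha>0$) if there are $\rho_0>0$ and $C>0$ such that for all $0<\rho\leq\rho_0$, all $\mathbf{x}\in\mathrm{Supp}(\mu)$, every affine hyperplane $\mathcal{L}\subset\mathbb{R}^k$ and every $\epsilon>0$, $\mu(B(\mathbf{x},\rho)\cap \mathcal{L}^{(\epsilon\rho)})\leq C\epsilon^\alpha\mu(B(\mathbf{x},\rho))$, where $A^{(r)}=\{\mathbf{y}:\mathrm{dist}(\mathbf{y},A)\leq r\}$ is the closed $r$-thickening. $\mu$ is Federer if there is $\rho_0>0$ with $\mu(B(\mathbf{x},2\rho))\leq C\mu(B(\mathbf{x},\rho))$ for all $\mathbf{x}\in\mathrm{Supp}(\mu)$, $0<\rho\leq\rho_0$. Absolutely $\alpha$-friendly means absolutely $\alpha$-decaying and Federer. $\mu$ is Ahlfors $\delta$-regular if there are $\rho_0>0$ and $C\geq1$ with $C^{-1}\rho^\delta\leq\mu(B(\mathbf{x},\rho))\leq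 C\rho^\delta$ for all $\mathbf{x}\in\mathrm{Supp}(\mu)$, $0<\rho\leq\rho_0$. A local coordinate chart $\Psi:U\to Z_{\mathrm{reg}}$ is a smooth diffeomorphism of $U$ onto an open subset of the manifold $Z_{\mathrm{reg}}$.
   Formalization: P is assumed irreducible over Q (the claim fails for P = x1·x2), μ is assumed nonzero, and Supp(ν) is taken inside the patch Ψ(U), i.e. Ψ(Supp μ), which is the usual support when Supp μ is compact; for the closure in R^d the claim can fail. *)

(* Defs.v *)
From HB Require Import structures.
From mathcomp Require Import all_boot all_order all_algebra.
From mathcomp Require Import all_classical all_reals all_analysis.
From mathcomp Require mpoly.
(* The notations of mpoly clash with those of the analysis library; the ones
   needed here are {mpoly T[n]} = mpoly n T and
   mpoly.msize, the total degree plus one. *)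
Import -(notations) mpoly.

Set Implicit Arguments.
Unset Strict Implicit.
Unset Printing Implicit Defensive.

Import Order.TTheory GRing.Theory Num.Theory.
Import numFieldNormedType.Exports.

Local Open Scope classical_set_scope.
Local Open Scope ring_scope.

(* Points of R^k are row vectors; the library norm on 'rV[R]_k is the max norm,
   and ball x rho is the open ball for that norm. *)

Section Quadric.
Variables (R : realType) (d : nat).
Implicit Type P : mpoly d int.

Definition quadratic P : Prop := mpoly.msize P = 3%N.

(* A quadric containing a regular piece of a rational hyperplane, such as
   x1 * x2 = 0, has omega >= d / (d - 1) > 1 on all of that hyperplane. *)
Definition irreducible_over_rat P : Prop :=
  forall f g : mpoly d rat,
    map_mpoly (intr : int -> rat) P = f * g ->
    (mpoly.msize f <= 1)%N \/ (mpoly.msize g <= 1)%N.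

Definition real_eval P (x : 'rV[R]_d) : R :=
  meval (fun i => x ord0 i) (map_mpoly (intr : int -> R) P).

Definition gradient P (x : 'rV[R]_d) : 'rV[R]_d :=
  \row_i real_eval (mderiv i P) x.

Definition zero_locus P : set 'rV[R]_d := [set x | real_eval P x = 0].

Definition regular_locus P : set 'rV[R]_d :=
  [set x | zero_locus P x /\ gradient P x != 0].

End Quadric.

Section IntrinsicApproximation.
Variables (R : realType) (d : nat).

Definition rational_point (p : 'rV[int]_d) (q : nat) : 'rV[R]_d :=
  \row_i ((p ord0 i)%:~R / q%:R).

(* q > 0 and (p, q) is a primitive vector of Z^(d+1), so that every rational
   point has exactly one such representation. *)
Definition lowest_terms (p : 'rV[int]_d) (q : nat) : Prop :=
  (0 < q)%N /\ gcdn q (\big[gcdn/0%N]_(i < d) `|p ord0 i|%N) = 1%N.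

Definition good_rational_points (Z : set 'rV[R]_d) (x : 'rV[R]_d) (c C : R)
    : set 'rV[R]_d :=
  [set r | Z r /\ exists p q, [/\ lowest_terms p q, r = rational_point p q
                                & `|x - r| <= C * q%:R `^ (- c)]].

(* The supremum is taken in [-oo, +oo]; it is -oo instead of 0 when no c > 0
   is admissible, which is immaterial for the sets very_well_approx below
   with c >= 0. *)
Definition omega (Z : set 'rV[R]_d) (x : 'rV[R]_d) : \bar R :=
  ereal_sup [set c%:E | c in
    [set c : R | 0 < c /\
       exists2 C : R, 0 < C & infinite_set (good_rational_points Z x c C)]].

Definition very_well_approx (c : R) (Z : set 'rV[R]_d) : set 'rV[R]_d :=
  [set x | Z x /\ (c%:E < omega Z x)%E].

End IntrinsicApproximation.

Section BorelMeasures.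
Variables (R : realType) (k : nat).

Definition borel_row : Type := g_sigma_algebraType (@open 'rV[R]_k).
HB.instance Definition _ := Measurable.on borel_row.

Implicit Type mu : {measure set borel_row -> \bar R}.

Definition locally_finite mu : Prop :=
  forall x : 'rV[R]_k, exists V : set 'rV[R]_k,
    [/\ open V, V x & (mu V < +oo)%E].

(* The support of m, seen as a measure on the topological subspace X. *)
Definition support_in (X : set 'rV[R]_k) (m : set 'rV[R]_k -> \bar R)
    : set 'rV[R]_k :=
  [set x | X x /\ forall V : set 'rV[R]_k, open V -> V x -> (0 < m V)%E].

Definition measure_support mu : set 'rV[R]_k := support_in setT mu.

Definition affine_hyperplane (L : set 'rV[R]_k) : Prop :=
  exists (a : 'rV[R]_k) (b : R),
    a != 0 /\ L = [set y | \sum_(i < k) a ord0 i * y ord0 i = b].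

Definition thickening (A : set 'rV[R]_k) (r : R) : set 'rV[R]_k :=
  [set y | (edist_inf A y <= r%:E)%E].

Definition absolutely_decaying (alpha : R) mu : Prop :=
  0 < alpha /\
  exists rho0 C : R, [/\ 0 < rho0, 0 < C &
    forall (rho : R) (x : 'rV[R]_k) (L : set 'rV[R]_k) (eps : R),
      0 < rho <= rho0 -> measure_support mu x -> affine_hyperplane L -> 0 < eps ->
      (mu (ball x rho `&` thickening L (eps * rho)) <=
         (C * eps `^ alpha)%:E * mu (ball x rho))%E].

Definition federer mu : Prop :=
  exists rho0 C : R, [/\ 0 < rho0, 0 < C &
    forall (x : 'rV[R]_k) (rho : R), measure_support mu x -> 0 < rho <= rho0 ->
      (mu (ball x (2 * rho)%R) <= C%:E * mu (ball x rho))%E].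

Definition absolutely_friendly (alpha : R) mu : Prop :=
  absolutely_decaying alpha mu /\ federer mu.

Definition ahlfors_regular (delta : R) mu : Prop :=
  exists rho0 C : R, [/\ 0 < rho0, 1 <= C &
    forall (x : 'rV[R]_k) (rho : R), measure_support mu x -> 0 < rho <= rho0 ->
      ((C^-1 * rho `^ delta)%:E <= mu (ball x rho))%E /\
      (mu (ball x rho) <= (C * rho `^ delta)%:E)%E].

End BorelMeasures.

Section Charts.
Variable R : realType.

Fixpoint Cr_on (m n : nat) (V : set 'rV[R]_m) (r : nat)
    (f : 'rV[R]_m -> 'rV[R]_n) : Prop :=
  (forall x, V x -> {for x, continuous f}) /\
  if r is r'.+1 then
    forall i : 'I_m,
      (forall x, V x -> derivable f x (delta_mx ord0 i)) /\
      Cr_on V r' ('D_(delta_mx ord0 i) f)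
  else True.

(* Meant for open V, so that the values of f off V are irrelevant. *)
Definition smooth_on (m n : nat) (V : set 'rV[R]_m)
    (f : 'rV[R]_m -> 'rV[R]_n) : Prop :=
  forall r, Cr_on V r f.

(* Smoothness on an arbitrary subset, in particular on a submanifold: local
   extendability to smooth maps on open sets of the ambient space. *)
Definition smooth_on_subset (m n : nat) (X : set 'rV[R]_m)
    (f : 'rV[R]_m -> 'rV[R]_n) : Prop :=
  forall x, X x -> exists (V : set 'rV[R]_m) (g : 'rV[R]_m -> 'rV[R]_n),
    [/\ open V, V x, smooth_on V g & forall z, V z -> X z -> g z = f z].

(* Only the values of psi on U matter. *)
Definition local_chart (k d : nat) (U : set 'rV[R]_k) (M : set 'rV[R]_d)
    (psi : 'rV[R]_k -> 'rV[R]_d) : Prop :=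
  [/\ open U, smooth_on U psi,
      exists2 V : set 'rV[R]_d, open V & psi @` U = M `&` V &
      exists2 phi : 'rV[R]_d -> 'rV[R]_k,
        forall x, U x -> phi (psi x) = x & smooth_on_subset (psi @` U) phi].

(* The pushforward of the restriction of mu to the domain U of the chart. As a
   measure on psi @` U its support is psi @` measure_support mu; this is also
   its support in R^d when measure_support mu is compact. Otherwise the support
   in R^d is the closure, which may have a larger Hausdorff dimension. *)
Definition chart_pushforward (k d : nat)
    (mu : {measure set borel_row R k -> \bar R}) (U : set 'rV[R]_k)
    (psi : 'rV[R]_k -> 'rV[R]_d) (A : set 'rV[R]_d) : \bar R :=
  mu (U `&` psi @^-1` A).

End Charts.

Section Hausdorff.
Variables (R : realType) (d : nat).
Implicit Type A : set 'rV[R]_d.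

(* 0 is added so that the empty set has diameter 0. *)
Definition diameter A : \bar R :=
  ereal_sup ([set 0%E] `|` [set (`|z.1 - z.2|)%:E | z in A `*` A]).

Definition hausdorff_premeasure (s eps : R) A : \bar R :=
  ereal_inf [set (\sum_(0 <= i <oo) diameter (F i) `^ s)%E | F in
    [set F : nat -> set 'rV[R]_d |
       A `<=` \bigcup_i F i /\ forall i, (diameter (F i) <= eps%:E)%E]].

Definition hausdorff_measure (s : R) A : \bar R :=
  ereal_sup [set hausdorff_premeasure s eps A | eps in [set e : R | 0 < e]].

(* Restricting to s > 0 avoids the 0 ^ 0 convention and does not change the
   infimum. The empty set has dimension 0. *)
Definition hausdorff_dim A : \bar R :=
  ereal_inf [set s%:E | s in
    [set s : R | 0 < s /\ hausdorff_measure s A = 0%E]].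

End Hausdorff.

(* Main.v *)
(** Write the quadric homogeneously, with integral polar form S. For rational
    points z = p / q and w = p' / q' of the quadric, S takes an integer value on
    (q, p) and (q', p') of size O(q q' |z - w|^2). Hence the rational points of
    height at most Q in a ball of radius small compared with 1 / Q are pairwise
    orthogonal: they span an isotropic subspace, and if its codimension were at
    most 1 the polynomial would have a linear factor over Q. So they lie on an
    affine subspace of dimension at most d - 2, whose preimage under the chart
    is, within a ball of radius r, at distance O(r^2) from a hyperplane.

    A point psi u within tau = rho^c of such a rational point, where
    Q = rho^(-1/b) with b > 1, therefore lies in thin slabs at all scales r
    between tau and rho. Decay and regularity give a cover of these u by
    O(rho^(-delta) (rho / tau)^(delta - alpha)) balls of radius tau, going from
    rho to tau in boundedly many steps r -> r^(1+g) with g <= 1. Summing over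
    rho = 2^(-bn) shows that the Hausdorff measure vanishes in every dimension
    s > delta - alpha (1 - 1/c). *)

Require Import Defs.
From HB Require Import structures.
From mathcomp Require Import all_boot all_order all_algebra.
From mathcomp Require Import all_classical all_reals all_analysis.
From mathcomp Require mpoly.
From mathcomp Require Import ring lra.
Import -(notations) mpoly.
Set Implicit Arguments.
Unset Strict Implicit.
Unset Printing Implicit Defensive.

Import Order.TTheory GRing.Theory Num.Theory.
Import numFieldNormedType.Exports.
Local Open Scope classical_set_scope.
Local Open Scope ring_scope.

(** * Quadratic Taylor estimates *)

Section Taylor.
Context {R : realType}.

Lemma rV_coord_le {n : nat} (x : 'rV[R]_n) (i : 'I_n) : `|x ord0 i| <= `|x|.
Proof.
rewrite [leRHS]/Num.Def.normr /= mx_normrE.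
exact: (@le_bigmax _ _ _ _ (fun ij : 'I_1 * 'I_n => `|x ij.1 ij.2|) (ord0, i)).
Qed.

Lemma rV_norm_le {n : nat} (x : 'rV[R]_n) (r : R) : 0 <= r ->
  (forall i, `|x ord0 i| <= r) -> `|x| <= r.
Proof.
move=> r0 H; rewrite [leLHS]/Num.Def.normr /= mx_normrE.
by apply: bigmax_le => // -[i j] _ /=; rewrite (ord1 i).
Qed.

Lemma sum_ge_term {I : finType} (F : I -> R) (i : I) :
  (forall j, 0 <= F j) -> F i <= \sum_j F j.
Proof. by move=> F0; rewrite (bigD1 i)//= lerDl sumr_ge0. Qed.

Lemma is_derive_line {m : nat} (f : 'rV[R]_m -> R) (y e : 'rV[R]_m) (t : R) :
  derivable f (y + t *: e) e ->
  is_derive t 1 (fun s : R => f (y + s *: e)) ('D_e f (y + t *: e)).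
Proof.
move=> df.
have E : (fun h : R => h^-1 *: (((fun s : R => f (y + s *: e)) \o shift t) (h *: 1) - f (y + t *: e)))
  = (fun h : R => h^-1 *: ((f \o shift (y + t *: e)) (h *: e) - f (y + t *: e))).
  apply/funext => h /=; congr (_ *: (f _ - _)).
  by rewrite scalerDl /GRing.scale /= mulr1 addrCA.
apply: DeriveDef; first by rewrite /derivable E.
by rewrite /derive E.
Qed.

Lemma segment_bound {m : nat} (f : 'rV[R]_m -> R) (y e : 'rV[R]_m) (a b K : R) :
  a <= b ->
  (forall s, a <= s <= b -> derivable f (y + s *: e) e /\
     `|'D_e f (y + s *: e)| <= K) ->
  `|f (y + b *: e) - f (y + a *: e)| <= K * (b - a).
Proof.
rewrite le_eqVlt => /orP[/eqP ->|ab H]; first by rewrite !subrr normr0 mulr0.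
have [||c cab ->] := @MVT R (fun s => f (y + s *: e)) (fun s => 'D_e f (y + s *: e)) _ _ ab.
- move=> x; rewrite in_itv /= => /andP[ax xb]; apply: is_derive_line.
  by apply: (H x _).1; rewrite !ltW.
- apply: derivable_within_continuous => x; rewrite in_itv /= => xab.
  by case: (is_derive_line (H x xab).1).
- move: cab; rewrite in_itv /= => /andP[ac cb].
  rewrite normrM (gtr0_norm (x := b - a)) ?subr_gt0// ler_wpM2r ?subr_ge0 ?(ltW ab)//.
  by apply: (H c _).2; rewrite !ltW.
Qed.

(** Centred at [w], so the signs of the coordinates of [z - w] do not matter, and [box y w] is
    contained in [box z w] as soon as [y] lies in [box z w]. *)
Definition box {m : nat} (z w : 'rV[R]_m) : set 'rV[R]_m :=
  [set y | forall i, `|y ord0 i - w ord0 i| <= `|z ord0 i - w ord0 i|].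

(* Move from w to z one coordinate at a time; the path stays in the box. *)
Lemma box_bound1 {m : nat} (f : 'rV[R]_m -> R) (z w : 'rV[R]_m) (K : R) :
  (forall y (i : 'I_m), box z w y -> derivable f y (delta_mx ord0 i) /\
     `|'D_(delta_mx ord0 i) f y| <= K) ->
  `|f z - f w| <= m%:R * K * `|z - w|.
Proof.
move=> H.
pose h (k : nat) : 'rV[R]_m := \row_i (if (i < k)%N then z ord0 i else w ord0 i).
have hm : h m = z by apply/rowP => i; rewrite mxE ltn_ord.
have h0 : h 0%N = w by apply/rowP => i; rewrite mxE ltn0.
have hS (k : 'I_m) : h k.+1 = h k + (z ord0 k - w ord0 k) *: delta_mx ord0 k.
  apply/rowP => i; rewrite !mxE eqxx /= ltnS leq_eqVlt.
  have [->|ik] := eqVneq i k; first by rewrite eqxx ltnn /= mulr1 subrKC.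
  by rewrite -val_eqE /= in ik; rewrite (negbTE ik) mulr0 addr0.
have step (k : 'I_m) : `|f (h k.+1) - f (h k)| <= K * `|z - w|.
  have K0 : 0 <= K.
    have bw : box z w w by move=> i; rewrite subrr normr0.
    exact: le_trans (normr_ge0 _) (H w k bw).2.
  apply: (@le_trans _ _ (K * `|z ord0 k - w ord0 k|)); last first.
    by rewrite ler_wpM2l//; have := rV_coord_le (z - w) k; rewrite !mxE.
  have inbox s : `|s| <= `|z ord0 k - w ord0 k| -> box z w (h k + s *: delta_mx ord0 k).
    move=> hs i; rewrite !mxE eqxx /=; have [->|ik] := eqVneq i k.
      by rewrite ltnn mulr1 addrAC subrr add0r.
    by rewrite mulr0 addr0; case: ifP; rewrite ?subrr ?normr0.
  rewrite hS; set t := z ord0 k - w ord0 k in inbox *.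
  have [t0|t0] := leP 0 t.
    have := @segment_bound m f (h k) (delta_mx ord0 k) 0 t K t0.
    rewrite scale0r addr0 subr0 (ger0_norm t0); apply => s /andP[s0 st].
    by apply: H; apply: inbox; rewrite !ger0_norm.
  have := @segment_bound m f (h k) (delta_mx ord0 k) t 0 K (ltW t0).
  rewrite scale0r addr0 sub0r distrC (ltr0_norm t0); apply => s /andP[s0 st].
  apply: H; apply: inbox; rewrite (ltr0_norm t0) ler0_norm// lerN2//.
have -> : f z - f w = \sum_(k < m) (f (h k.+1) - f (h k)).
  by rewrite -(big_mkord xpredT (fun k => f (h k.+1) - f (h k))) telescope_sumr// hm h0.
apply: le_trans (ler_norm_sum _ _ _) _.
apply: (@le_trans _ _ (\sum_(k < m) K * `|z - w|)).
  by apply: ler_sum => k _; exact: step.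
by rewrite sumr_const card_ord -[leLHS]mulr_natl mulrA.
Qed.

(** The max norm lets each coordinate of [f] be treated separately, so the constant of the scalar
    case is unchanged. *)
Lemma box_bound {m n : nat} (f : 'rV[R]_m -> 'rV[R]_n) (z w : 'rV[R]_m) (K : R) :
  0 <= K ->
  (forall y (i : 'I_m), box z w y -> derivable f y (delta_mx ord0 i) /\
     `|'D_(delta_mx ord0 i) f y| <= K) ->
  `|f z - f w| <= m%:R * K * `|z - w|.
Proof.
move=> K0 H; apply: rV_norm_le; first by rewrite !mulr_ge0.
move=> j; have := @box_bound1 m (fun y => f y ord0 j) z w K.
have -> : (f z - f w) ord0 j = f z ord0 j - f w ord0 j by rewrite !mxE.
apply => y i /(H y i)[dy Dy]; split; first by move/derivable_mxP : dy; apply.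
apply: le_trans Dy; rewrite (derive_mx dy).
by apply: le_trans (rV_coord_le _ j); rewrite mxE.
Qed.

Lemma is_derive_mulmx {m n : nat} (D : 'M[R]_(m, n)) (w a v : 'rV[R]_m) :
  is_derive a v (fun y => (y - w) *m D) (v *m D).
Proof.
have E : \forall h \near 0^', h^-1 *: (((fun y => (y - w) *m D) \o shift a) (h *: v) - (a - w) *m D) = v *m D.
  near=> h; have h0 : h != 0 by near: h; exact: nbhs_dnbhs_neq.
  by rewrite /= -mulmxBl opprB addrA subrK addrK -scalemxAl scalerA mulVf// scale1r.
have C : h^-1 *: (((fun y => (y - w) *m D) \o shift a) (h *: v) - (a - w) *m D) @[h --> 0^'] --> v *m D.
  by apply: cvg_near_cst.
apply: DeriveDef; first by apply/cvg_ex; exists (v *m D).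
exact: cvg_lim C.
Unshelve. all: by end_near. Qed.

(** Bounded second derivatives make the first derivatives Lipschitz. The mean value bound, applied
    to [g] minus its linear part at [w], then gives the quadratic remainder. The constants are
    uniform in the base point [w], which will be a rational point near [z0] rather than [z0]
    itself. *)
Lemma taylor2 {m n : nat} (V : set 'rV[R]_m) (g : 'rV[R]_m -> 'rV[R]_n) (z0 : 'rV[R]_m) :
  open V -> V z0 -> Cr_on V 2 g ->
  exists (eta K : R), [/\ 0 < eta, 0 < K & forall w, ball z0 eta w ->
    [/\ V w, forall z, ball z0 eta z -> `|g z - g w| <= K * `|z - w| &
    exists D : 'M[R]_(m, n), forall z, ball z0 eta z ->
      `|g z - g w - (z - w) *m D| <= K * `|z - w| ^+ 2]].
Proof.
move=> oV Vz0 [_ /= H].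
pose e (i : 'I_m) : 'rV[R]_m := delta_mx ord0 i.
have bnd (f : 'rV[R]_m -> 'rV[R]_n) : {for z0, continuous f} ->
    \forall z \near z0, `|f z| <= `|f z0| + 1.
  move=> cf; have /cvgr_dist_le := cf; move=> /(_ 1 ltr01).
  apply: filterS => z hz; rewrite -[f z](subrK (f z0)) addrC.
  by apply: le_trans (ler_normD _ _) _; rewrite lerD2l distrC.
pose K1 := \sum_(i < m) (`|'D_(e i) g z0| + 1).
pose K2 := \sum_(i < m) \sum_(j < m) (`|'D_(e j) ('D_(e i) g) z0| + 1).
have K1i (i : 'I_m) : `|'D_(e i) g z0| + 1 <= K1.
  by apply: (@sum_ge_term 'I_m (fun i => `|'D_(e i) g z0| + 1)) => j; rewrite addr_ge0.
have K2i (i j : 'I_m) : `|'D_(e j) ('D_(e i) g) z0| + 1 <= K2.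
  apply: (@le_trans _ _ (\sum_(j < m) (`|'D_(e j) ('D_(e i) g) z0| + 1))).
    by apply: (@sum_ge_term 'I_m (fun j => `|'D_(e j) ('D_(e i) g) z0| + 1)) => l; rewrite addr_ge0.
  apply: (@sum_ge_term 'I_m (fun i => \sum_(j < m) (`|'D_(e j) ('D_(e i) g) z0| + 1))) => l.
  by apply: sumr_ge0 => k _; rewrite addr_ge0.
have : \forall z \near z0, V z /\ (forall i : 'I_m, `|'D_(e i) g z| <= K1) /\
   forall i j : 'I_m, `|'D_(e j) ('D_(e i) g) z| <= K2.
  apply: filterI; first exact: open_nbhs_nbhs.
  apply: filterI.
    apply: (@filter_forall _ 'I_m (fun i x => `|'D_(e i) g x| <= K1) (nbhs z0) _) => i; have /bnd := (H i).2.1 z0 Vz0.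
    by apply: filterS => z /le_trans; apply.
  apply: (@filter_forall _ 'I_m (fun i x => forall j : 'I_m, `|'D_(e j) ('D_(e i) g) x| <= K2) (nbhs z0) _) => i.
  apply: (@filter_forall _ 'I_m (fun j x => `|'D_(e j) ('D_(e i) g) x| <= K2) (nbhs z0) _) => j.
  have /bnd := ((H i).2.2 j).2.1 z0 Vz0.
  by apply: filterS => z /le_trans; apply.
move=> /nbhs_ballP[eps /= eps0 B].
(* The first summand is the Lipschitz constant, the second the constant of the quadratic remainder,
   and 1 makes [M] positive. *)
pose M := m%:R * K1 + m%:R * (m%:R * K2) + 1.
have K10 : 0 <= K1 by apply: sumr_ge0 => *; exact: addr_ge0.
have K20 : 0 <= K2 by do 2 (apply: sumr_ge0 => ? _); exact: addr_ge0.
have M0 : 0 < M by rewrite /M ltr_wpDl// addr_ge0 ?mulr_ge0.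
(* If [z] and [w] are within [eps / 3] of [z0], then [box z w] stays within [2 eps / 3] of [w],
   hence inside the ball of radius [eps] where the derivatives are controlled. *)
exists (eps / 3), M; split => [||w wb]; [by rewrite divr_gt0|exact: M0|].
have boxB z y : ball z0 (eps / 3) z -> box z w y -> ball z0 eps y.
  move: wb; rewrite -!ball_normE /= => wb zb yb.
  have : `|y - w| <= `|z - w|.
    by apply: rV_norm_le => // i; apply: le_trans (rV_coord_le _ i); rewrite !mxE; exact: yb.
  have : `|z - w| <= `|z0 - w| + `|z0 - z|.
    by rewrite [leRHS]addrC (distrC z0 z); apply: ler_distD.
  have : `|z0 - y| <= `|z0 - w| + `|y - w| by rewrite (distrC y); apply: ler_distD.
  lra.
have sub z : ball z0 (eps / 3) z -> ball z0 eps z.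
  by apply: le_ball; rewrite ler_pdivrMr// ler_peMr ?(ltW eps0)//; lra.
have lipD i z : ball z0 (eps / 3) z -> forall y, box z w y ->
    `|'D_(e i) g y - 'D_(e i) g w| <= m%:R * K2 * `|y - w|.
  move=> zb y yb; apply: (@box_bound m n ('D_(e i) g) y w K2 K20) => x j xb.
  have xb' : box z w x by move=> l; exact: le_trans (xb l) (yb l).
  have [Vx [_ B2]] := B x (boxB z x zb xb').
  by split; [exact: ((H i).2.2 j).1|exact: B2].
split.
- exact: (B w (sub w wb)).1.
- move=> z zb; apply: (@le_trans _ _ (m%:R * K1 * `|z - w|)).
    apply: (@box_bound m n g z w K1 K10) => y i /(boxB z y zb) /B[Vy [B1 _]].
    by split; [exact: (H i).1|exact: B1].
  by rewrite ler_wpM2r// /M -addrA lerDl addr_ge0// ?mulr_ge0.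
exists (\matrix_i 'D_(e i) g w) => z zb.
set D := \matrix_i _.
have De i : e i *m D = 'D_(e i) g w by rewrite -rowE rowK.
(* The partial derivatives of [h] at [y] are the increments of those of [g] from [w] to [y], which
   [lipD] bounds. *)
pose h y := g y - (y - w) *m D.
have -> : g z - g w - (z - w) *m D = h z - h w.
  by rewrite /h subrr mul0mx subr0 addrAC.
have B0 : 0 <= m%:R * K2 * `|z - w| by rewrite !mulr_ge0.
have -> : M * `|z - w| ^+ 2 = m%:R * (m%:R * K2 * `|z - w|) * `|z - w| + (m%:R * K1 + 1) * `|z - w| ^+ 2.
  by rewrite /M; ring.
apply: (@le_trans _ _ (m%:R * (m%:R * K2 * `|z - w|) * `|z - w|)); last first.
  by rewrite lerDl mulr_ge0 ?addr_ge0 ?mulr_ge0 ?exprn_ge0.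
apply: (@box_bound m n h z w _ B0) => y i yb.
have [Vy _] := B y (boxB z y zb yb).
have dg := (H i).1 y Vy.
have dl := is_derive_mulmx D w y (e i).
have dgd : is_derive y (e i) g ('D_(e i) g y) by exact: DeriveDef.
have dh : is_derive y (e i) h ('D_(e i) g y - e i *m D) by exact: is_deriveB.
split; first by case: dh.
rewrite derive_val De; apply: le_trans (lipD i z zb y yb) _.
rewrite ler_wpM2l ?mulr_ge0//.
by apply: rV_norm_le => // l; apply: le_trans (rV_coord_le _ l); rewrite !mxE; exact: yb.
Qed.

End Taylor.

(** * Rational points on a quadric *)

Section Algebra.
Context {d : nat}.

Definition homogenize {T : nzRingType} (x : 'rV[T]_d) : 'rV[T]_(1 + d) :=
  row_mx 1%:M x.

Definition bilform {T : nzRingType} {n : nat} (A : 'M[T]_n) (v w : 'rV[T]_n) : T :=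
  (v *m A *m w^T) ord0 ord0.

Lemma rmorph_bilform {S T : nzRingType} (f : {rmorphism S -> T}) {n : nat}
    (A : 'M[S]_n) (v w : 'rV[S]_n) :
  f (bilform A v w) = bilform (map_mx f A) (map_mx f v) (map_mx f w).
Proof. by rewrite /bilform map_trmx -!map_mxM [RHS]mxE. Qed.

Lemma map_homogenize {S T : nzRingType} (f : {rmorphism S -> T}) (x : 'rV[S]_d) :
  map_mx f (homogenize x) = homogenize (map_mx f x).
Proof. by rewrite /homogenize map_row_mx map_mx1. Qed.

Definition homvars (T : nzRingType) : 'rV[mpoly d T]_(1 + d) :=
  homogenize (\row_i mpolyX T (mnm1 i)).

Lemma homvars0 (T : nzRingType) : homvars T ord0 (lshift d ord0) = 1.
Proof. by rewrite /homvars /homogenize row_mxEl mxE. Qed.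

Lemma monomial_deg1 (T : nzRingType) (m : multinom d) : (mdeg m <= 1)%N ->
  exists i, mpolyX T m = homvars T ord0 i.
Proof.
rewrite leq_eqVlt ltnS leqn0 => /orP[|].
  move=> /mdeg1P [i /eqP ->]; exists (rshift 1 i).
  by rewrite /homvars /homogenize row_mxEr mxE.
rewrite mdeg_eq0 => /eqP ->; exists (lshift d ord0).
by rewrite homvars0 mpolyX0.
Qed.

(** The constant 1 is an entry of [homvars], so monomials of degree 0 and 1 are covered as well. *)
Lemma monomial_deg2 (T : nzRingType) (m : multinom d) : (mdeg m <= 2)%N ->
  exists i j, mpolyX T m = homvars T ord0 i * homvars T ord0 j.
Proof.
move=> m2; have [m0|/eqP m0] := eqVneq (mdeg m) 0%N.
  have [|i ->] := @monomial_deg1 T m; first by rewrite m0.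
  exists i, (lshift d ord0).
  by rewrite homvars0 mulr1.
have [i mi] : exists i, m i != 0%N.
  apply/existsP; apply: contra_notT m0; rewrite negb_exists => /forallP m0.
  by rewrite mdegE big1// => i _; apply/eqP; move: (m0 i); rewrite negbK.
have mE : (mnm_add (mnm_sub m (mnm1 i)) (mnm1 i)) = m.
  by apply: submK; rewrite lep1mP.
have md : (mdeg (mnm_sub m (mnm1 i)) <= 1)%N.
  by rewrite -ltnS (leq_trans _ m2)// -[in leqRHS]mE mdegD mdeg1 addn1.
have [j Ej] := @monomial_deg1 T _ md.
have [|k Ek] := @monomial_deg1 T (mnm1 i); first by rewrite mdeg1.
by exists j, k; rewrite -mE mpolyXD Ej Ek.
Qed.

(** Symmetrising the matrix would bring in halves, so [A] is left integral and possibly asymmetric;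
    the polar form of [P] is then given by [A + A^T]. *)
Lemma quadratic_bilform (P : mpoly d int) : (mpoly.msize P <= 3)%N ->
  exists A : 'M[int]_(1 + d), P = bilform (map_mx intr A) (homvars int) (homvars int).
Proof.
move=> P3; rewrite {1}[P]mpolyE big_seq.
apply: (big_ind (fun p : mpoly d int => exists A : 'M[int]_(1 + d),
  p = bilform (map_mx intr A) (homvars int) (homvars int))).
- by exists 0; rewrite /bilform map_mx0 mulmx0 mul0mx mxE.
- move=> _ _ [A ->] [B ->]; exists (A + B).
  by rewrite /bilform map_mxD mulmxDr mulmxDl [RHS]mxE.
- move=> m mP; have [|i [j ->]] := @monomial_deg2 int m.
    by rewrite -ltnS (leq_trans _ P3)//; apply: msize_mdeg_lt.
  exists (mcoeff m P *: delta_mx i j).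
  have scE (c : int) (p : mpoly d int) : c *: p = c%:~R * p.
    by rewrite -mul_mpolyC -{1}(intz c) rmorph_int.
  rewrite map_mxZ map_delta_mx /bilform -scalemxAr -scalemxAl [RHS]mxE scE.
  congr (_ * _).
  rewrite [RHS]mxE (bigD1 j)//= big1 ?addr0; last first.
    move=> k kj; rewrite [(_ *m _) _ _]mxE big1 ?mul0r// => l _.
    by rewrite [delta_mx _ _ _ _]mxE (negbTE kj) andbF mulr0.
  rewrite [(_ *m _) _ _]mxE (bigD1 i)//= big1 ?addr0; last first.
    by move=> k kj; rewrite [delta_mx _ _ _ _]mxE (negbTE kj) mulr0.
  by rewrite [delta_mx _ _ _ _]mxE !eqxx mulr1 [_^T _ _]mxE.
Qed.

Lemma row_free_extend {F : fieldType} {r n : nat} (M : 'M[F]_(r, n)) (v : 'rV[F]_n) :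
  row_free M -> ~~ (v <= M)%MS -> row_free (col_mx v M).
Proof.
rewrite /row_free => /eqP rM vM; rewrite eqn_leq rank_leq_row /=.
have : (M < v + M)%MS by rewrite ltmxE addsmxSr /= addsmx_sub (negbTE vM).
by move=> /rank_ltmx; rewrite rM addsmxE.
Qed.

(** Complete the [d] isotropic rows by one vector [e] to a basis. In that basis the Gram matrix
    vanishes outside its first row and column, so it has the shape [E0^T b + b^T E0]; changing the
    basis back gives [l] and [h]. *)
Lemma isotropic_factor {F : numFieldType} (S : 'M[F]_(1 + d)) (M : 'M[F]_(d, 1 + d)) :
  S^T = S -> row_free M -> M *m S *m M^T = 0 ->
  exists l h : 'cV[F]_(1 + d), S = l *m h^T + h *m l^T.
Proof.
move=> Ssym fM iso.
have [e eM] : exists e : 'rV[F]_(1 + d), ~~ (e <= M)%MS.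
  apply/not_existsP => H; have : (1%:M <= M)%MS.
    by apply/row_subP => i; move: (H (row i 1%:M)) => /negP; rewrite negbK.
  by move/mxrankS; rewrite mxrank1 (eqP fM) add1n ltnn.
pose N : 'M[F]_(1 + d) := col_mx e M.
have uN : N \in unitmx by rewrite -row_free_unit; apply: row_free_extend.
pose E0 : 'rV[F]_(1 + d) := row_mx 1%:M 0.
(* The corner entry receives a contribution from both summands, hence the factor [1/2]. *)
pose b : 'rV[F]_(1 + d) := row_mx (2^-1 *: (e *m S *m e^T)) (e *m S *m M^T).
have NE : N *m S *m N^T = E0^T *m b + b^T *m E0.
  rewrite /N /E0 /b !tr_row_mx tr_col_mx mul_col_mx mul_col_row !trmx1 !trmx0.
  rewrite !mul_col_row !mul1mx !mulmx1 !mul0mx !mulmx0 add_block_mx !addr0 !add0r.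
  rewrite iso; congr (block_mx _ _ _ _).
    have -> : (2^-1 *: (e *m S *m e^T))^T = 2^-1 *: (e *m S *m e^T).
      by rewrite linearZ /= !trmx_mul trmxK Ssym mulmxA.
    by rewrite -scalerDl -mulr2n -[X in X *: _]mulr_natl mulfV ?scale1r// pnatr_eq0.
  by rewrite !trmx_mul trmxK Ssym mulmxA.
exists (invmx N *m E0^T), (invmx N *m b^T).
have -> : S = invmx N *m (N *m S *m N^T) *m (invmx N)^T.
  by rewrite !mulmxA mulVmx// mul1mx -mulmxA -trmx_mul mulVmx// trmx1 mulmx1.
by rewrite NE mulmxDr mulmxDl !trmx_mul !trmxK !mulmxA.
Qed.

(** A maximal independent family of vectors of [V] spans [V]. By [isotropic_factor] it cannot have
    [d] members, since [S] would then split. *)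
Lemma isotropic_span {F : numFieldType} (S : 'M[F]_(1 + d)) (V : set 'rV[F]_(1 + d)) :
  S^T = S -> (forall v w, V v -> V w -> bilform S v w = 0) ->
  (~ exists l h : 'cV[F]_(1 + d), S = l *m h^T + h *m l^T) ->
  exists (r : nat) (M : 'M[F]_(r, 1 + d)), (r < d)%N /\ forall v, V v -> (v <= M)%MS.
Proof.
move=> Ssym iso nofac.
(* The cap [r <= d] guarantees a maximum; once [r < d] is known, a further independent vector stays
   within the cap and contradicts maximality. *)
pose Q (r : nat) := `[< (r <= d)%N /\ exists M : 'M[F]_(r, 1 + d),
   row_free M /\ forall i, V (row i M) >].
have Q0 : exists r, Q r.
  exists 0%N; apply/asboolP; split => //; exists 0; split; last by case.
  by rewrite /row_free mxrank0.
have [r /asboolP[rd [M [fM VM]]] rmax] := @ex_maxnP Q d Q0 (fun r => fun H => proj1 (asboolP _ H)).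
have rd' : (r < d)%N.
  rewrite ltn_neqAle rd andbT; apply/eqP => rE; subst r; apply: nofac.
  apply: (@isotropic_factor F S M) => //.
  apply/matrixP => i j; rewrite [RHS]mxE -(iso _ _ (VM i) (VM j)) /bilform [LHS]mxE [RHS]mxE.
  apply: eq_bigr => k _; rewrite !mxE; congr (_ * _).
  by apply: eq_bigr => l _; rewrite !mxE.
exists r, M; split => // v Vv; apply: contraT => vM.
have : Q (1 + r)%N.
  apply/asboolP; split => //; exists (col_mx v M).
  split; first exact: row_free_extend.
  move=> i; rewrite -(splitK i); case: (fintype.split i) => j /=.
    by rewrite rowKu (ord1 j) row_id.
  by rewrite rowKd.
by move=> /rmax; rewrite add1n ltnn.
Qed.

Lemma bilformD {T : nzRingType} {n : nat} (A B : 'M[T]_n) (v w : 'rV[T]_n) :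
  bilform (A + B) v w = bilform A v w + bilform B v w.
Proof. by rewrite /bilform mulmxDr mulmxDl [LHS]mxE. Qed.

Lemma bilform_tr {T : comNzRingType} {n : nat} (A : 'M[T]_n) (v w : 'rV[T]_n) :
  bilform A^T v w = bilform A w v.
Proof.
rewrite /bilform -[v in LHS]trmxK -trmx_mul -trmx_mul mulmxA.
by rewrite [LHS]mxE.
Qed.

Lemma bilform_rank1 {T : comNzRingType} {n : nat} (l h : 'cV[T]_n) (v : 'rV[T]_n) :
  bilform (l *m h^T) v v = (v *m l) ord0 ord0 * (v *m h) ord0 ord0.
Proof.
rewrite /bilform mulmxA -mulmxA -trmx_mul [LHS]mxE big_ord1.
by rewrite [(_ *m _)^T _ _]mxE.
Qed.

Lemma msize_linear_form (l : 'cV[rat]_(1 + d)) :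
  (mpoly.msize ((homvars rat *m map_mx (mpolyC d (R:=rat)) l) ord0 ord0) <= 2)%N.
Proof.
rewrite [(_ *m _) _ _]mxE.
apply: (big_ind (fun p : mpoly d rat => (mpoly.msize p <= 2)%N)).
- by rewrite mmeasure0.
- by move=> p q hp hq; apply: leq_trans (mmeasureD_le _ _ _) _; rewrite geq_max hp.
- move=> i _; rewrite [map_mx _ _ _ _]mxE mulrC mul_mpolyC.
  apply: leq_trans (msizeZ_le _ _) _.
  rewrite -(splitK i); case: (fintype.split i) => j /=.
    by rewrite (ord1 j) homvars0 msize1.
  by rewrite /homvars /homogenize row_mxEr mxE msizeX mdeg1.
Qed.

Lemma map_homvars {S T : nzRingType} (f : {rmorphism S -> T}) :
  map_mx (map_mpoly f) (homvars S) = homvars T.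
Proof.
rewrite /homvars map_homogenize; congr homogenize.
by apply/rowP => i; rewrite !mxE; exact: map_mpolyX.
Qed.

Lemma map_mx_intr {S T : nzRingType} (f : {rmorphism S -> T}) {m n : nat} (A : 'M[int]_(m, n)) :
  map_mx f (map_mx intr A) = map_mx intr A.
Proof. by apply/matrixP => i j; rewrite !mxE rmorph_int. Qed.

(** Evaluated at [homvars], such a decomposition of the polar form reads [2 P = 2 f g] with [f] and
    [g] of degree at most 1, so [P] would be reducible over the rationals. *)
Lemma irreducible_no_factor (P : mpoly d int) (A : 'M[int]_(1 + d)) :
  quadratic P -> irreducible_over_rat P ->
  P = bilform (map_mx intr A) (homvars int) (homvars int) ->
  ~ exists l h : 'cV[rat]_(1 + d), map_mx intr (A + A^T) = l *m h^T + h *m l^T.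
Proof.
move=> qP irrP PE [l [h AE]].
pose PQ : mpoly d rat := map_mpoly (intr : int -> rat) P.
have PQE : PQ = bilform (map_mx intr A) (homvars rat) (homvars rat).
  by rewrite /PQ {1}PE rmorph_bilform map_mx_intr map_homvars.
have PQ3 : mpoly.msize PQ = 3%N.
  rewrite -[RHS]qP !msizeE; apply: perm_big.
  by apply: msupp_map_mpoly; exact: intr_inj.
pose f := (homvars rat *m map_mx (mpolyC d (R:=rat)) l) ord0 ord0.
pose g := (homvars rat *m map_mx (mpolyC d (R:=rat)) h) ord0 ord0.
have fg : PQ = f * g.
  have : bilform (map_mx (mpolyC d (R:=rat)) (map_mx intr (A + A^T))) (homvars rat) (homvars rat) = f * g + g * f.
    by rewrite AE map_mxD !map_mxM bilformD -!map_trmx !bilform_rank1.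
  rewrite map_mx_intr map_mxD -map_trmx bilformD bilform_tr -PQE (mulrC g f) -(mulr2n PQ) -(mulr2n (f * g)).
  have two0 : (2 : rat) != 0 by [].
  by rewrite -(scaler_nat 2 PQ) -(scaler_nat 2 (f * g)) => /(scalerI two0).
have f0 : f != 0 by apply/eqP => f0; move: PQ3; rewrite fg f0 mul0r mmeasure0.
have g0 : g != 0 by apply/eqP => g0; move: PQ3; rewrite fg g0 mulr0 mmeasure0.
have := msize_linear_form l; have := msize_linear_form h; rewrite -/f -/g => g2 f2.
(* Since [msize] is the degree plus one, a product of size 3 needs factors whose sizes add up to 4;
   a constant and a factor of size at most 2 reach only 3. *)
move: PQ3; rewrite fg msizeM//; have [] := irrP f g fg => h1.
  have : (mpoly.msize f + mpoly.msize g <= 1 + 2)%N by apply: leq_add.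
  by case: (mpoly.msize f + mpoly.msize g)%N => // n; rewrite /= => nn ne; rewrite ne in nn.
have : (mpoly.msize f + mpoly.msize g <= 2 + 1)%N by apply: leq_add.
by case: (mpoly.msize f + mpoly.msize g)%N => // n; rewrite /= => nn ne; rewrite ne in nn.
Qed.

End Algebra.

(** * Hyperplanes containing nearby rational points of bounded height *)

Section Simplex.
Context {R : realType} {d : nat}.

Lemma real_eval_bilform (P : mpoly d int) (A : 'M[int]_(1 + d)) (z : 'rV[R]_d) :
  P = bilform (map_mx intr A) (homvars int) (homvars int) ->
  real_eval P z = bilform (map_mx intr A) (homogenize z) (homogenize z).
Proof.
move=> PE; rewrite /real_eval {1}PE (rmorph_bilform (map_mpoly (intr : int -> R))).
rewrite map_mx_intr map_homvars (rmorph_bilform (meval (fun i => z ord0 i))) map_mx_intr.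
suff -> : map_mx (meval (fun i => z ord0 i)) (homvars R) = homogenize z by [].
rewrite /homvars map_homogenize; congr homogenize.
by apply/rowP => i; rewrite !mxE; exact: mevalXU.
Qed.

Lemma bilform_bound {n : nat} (A : 'M[R]_n) (v : 'rV[R]_n) :
  `|bilform A v v| <= (\sum_j \sum_i `|A i j|) * `|v| ^+ 2.
Proof.
rewrite /bilform mxE; apply: le_trans (ler_norm_sum _ _ _) _.
rewrite mulr_suml; apply: ler_sum => j _; rewrite normrM mulr_suml [_^T _ _]mxE.
rewrite mxE -[X in X * _]/(`|_|).
apply: (@le_trans _ _ ((\sum_i `|v ord0 i * A i j|) * `|v ord0 j|)).
  by rewrite ler_wpM2r// ler_norm_sum.
rewrite mulr_suml; apply: ler_sum => i _; rewrite normrM mulrAC mulrC expr2.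
by rewrite ler_wpM2l// ler_pM// rV_coord_le.
Qed.

(** Only the mixed terms survive when [v] and [w] are isotropic. This expresses the polar form at
    two points of the quadric through their difference, quadratically. *)
Lemma bilform_sub {T : comNzRingType} {n : nat} (A : 'M[T]_n) (v w : 'rV[T]_n) :
  bilform A v v = 0 -> bilform A w w = 0 ->
  bilform A (v - w) (v - w) = - bilform (A + A^T) v w.
Proof.
move=> v0 w0; rewrite bilformD bilform_tr /bilform.
move: v0 w0; rewrite /bilform linearB /= mulmxBl mulmxBr !mulmxBl.
move: (v *m A *m v^T) (w *m A *m w^T) (v *m A *m w^T) (w *m A *m v^T) => X1 X2 X3 X4.
by move=> X10 X20; rewrite !mxE X10 X20 sub0r subr0 opprD addrC.
Qed.

(** The vector [homogenize (rational_point R p q)] with its denominator cleared. *)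
Definition int_lift (p : 'rV[int]_d) (q : nat) : 'rV[int]_(1 + d) :=
  row_mx (q%:Z)%:M p.

Lemma homogenize_rational (p : 'rV[int]_d) (q : nat) : (0 < q)%N ->
  homogenize (rational_point R p q) = q%:R^-1 *: map_mx intr (int_lift p q).
Proof.
move=> q0; have q0' : (q%:R : R) != 0 by rewrite pnatr_eq0 -lt0n.
rewrite /homogenize /int_lift map_row_mx scale_row_mx; congr row_mx.
  by rewrite map_scalar_mx scale_scalar_mx mulVf.
by apply/rowP => i; rewrite !mxE mulrC.
Qed.

Lemma norm_homogenize_sub (z w : 'rV[R]_d) : `|homogenize z - homogenize w| <= `|z - w|.
Proof.
apply: rV_norm_le => // i; rewrite /homogenize opp_row_mx add_row_mx subrr.
rewrite -(splitK i); case: (fintype.split i) => j /=.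
  by rewrite row_mxEl mxE normr0.
by rewrite row_mxEr rV_coord_le.
Qed.

Lemma bilformZ {T : comNzRingType} {n : nat} (A : 'M[T]_n) (a b : T) (v w : 'rV[T]_n) :
  bilform A (a *: v) (b *: w) = a * b * bilform A v w.
Proof.
by rewrite /bilform linearZ /= -scalemxAr -!scalemxAl scalerA [LHS]mxE (mulrC b).
Qed.

(* The polar form takes integer values on the integral lifts, and these are
   smaller than 1 in absolute value. *)
Lemma rational_points_orthogonal (P : mpoly d int) (A : 'M[int]_(1 + d)) :
  P = bilform (map_mx intr A) (homvars int) (homvars int) ->
  exists2 kappa : R, 0 < kappa & forall (Q : R) p1 q1 p2 q2,
    (0 < q1)%N -> (0 < q2)%N -> q1%:R <= Q -> q2%:R <= Q ->
    zero_locus P (rational_point R p1 q1) -> zero_locus P (rational_point R p2 q2) ->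
    `|rational_point R p1 q1 - rational_point R p2 q2| * Q <= kappa ->
    bilform (A + A^T) (int_lift p1 q1) (int_lift p2 q2) = 0.
Proof.
move=> PE; pose C : R := \sum_j \sum_i `|map_mx intr A i j|.
have C0 : 0 <= C by apply: sumr_ge0 => ? _; apply: sumr_ge0.
(* Chosen so that [C * kappa ^ 2 < 1], where [C] bounds the quadratic form relative to the squared
   norm. *)
exists (C + 1)^-1; first by rewrite invr_gt0 ltr_wpDl.
move=> Q p1 q1 p2 q2 q10 q20 q1Q q2Q Z1 Z2 dQ.
set z1 := rational_point R p1 q1 in Z1 dQ *; set z2 := rational_point R p2 q2 in Z2 dQ *.
have Q0 : 0 <= Q by apply: le_trans q1Q.
set n := bilform _ _ _.
have nE : (n%:~R : R) = - (q1%:R * q2%:R * bilform (map_mx intr A) (homogenize z1 - homogenize z2) (homogenize z1 - homogenize z2)).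
  rewrite bilform_sub -?(real_eval_bilform _ PE)// mulrN opprK.
  rewrite /n (rmorph_bilform (intr : int -> R)) /z1 /z2 !homogenize_rational//.
  rewrite bilformZ map_mxD map_trmx.
  have q1n : (q1%:R : R) != 0 by rewrite pnatr_eq0 -lt0n.
  have q2n : (q2%:R : R) != 0 by rewrite pnatr_eq0 -lt0n.
  by rewrite -invfM mulrA mulfV ?mul1r// mulf_neq0.
have nlt : `|(n%:~R : R)| < 1.
  rewrite nE normrN normrM.
  apply: (@le_lt_trans _ _ (Q * Q * (C * `|z1 - z2| ^+ 2))).
    apply: ler_pM => //.
      by rewrite ger0_norm ?mulr_ge0// ler_pM.
    apply: le_trans (bilform_bound _ _) _; apply: ler_wpM2l => //.
    by rewrite lerXn2r ?nnegrE ?norm_homogenize_sub.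
  have -> : Q * Q * (C * `|z1 - z2| ^+ 2) = C * (`|z1 - z2| * Q) ^+ 2 by ring.
  apply: (@le_lt_trans _ _ (C * ((C + 1)^-1) ^+ 2)).
    by rewrite ler_wpM2l// lerXn2r ?nnegrE ?mulr_ge0 ?invr_ge0 ?addr_ge0.
  rewrite exprVn ltr_pdivrMr ?exprn_gt0 ?ltr_wpDl// mul1r.
  by rewrite sqrrD1 -addrA ltr_wpDl ?exprn_ge0// mulr2n; lra.
by move: nlt; rewrite -intr_norm -[1]/(1%:~R) ltr_int; case: (n) => [[|k]|k].
Qed.

(** The integral lifts of the points of [T] span a space of dimension at most [d - 1]. The affine
    map [z |-> (z - z0) *m D] is linear on lifts and kills the lift of [z0], so its image has
    dimension at most [d - 2] and lies in a hyperplane of the parameter space. In the application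
    [D] is the derivative of an inverse chart at [z0]. *)
Lemma rational_simplex (P : mpoly d int) : quadratic P -> irreducible_over_rat P ->
  exists2 kappa : R, 0 < kappa & forall (Q : R) (T : set 'rV[R]_d),
    (forall z, T z -> zero_locus P z /\ exists p q,
       [/\ (0 < q)%N, q%:R <= Q & z = rational_point R p q]) ->
    (forall z w, T z -> T w -> `|z - w| * Q <= kappa) ->
    forall z0, T z0 -> forall D : 'M[R]_(d, d.-1),
    exists2 a : 'cV[R]_(d.-1), a != 0 & forall z, T z -> (z - z0) *m D *m a = 0.
Proof.
move=> qP irrP; have [|A PE] := @quadratic_bilform d P; first by rewrite qP.
have [kappa kappa0 ortho] := rational_points_orthogonal PE.
exists kappa => // Q T TP Tk z0 Tz0 D.
(* The span is taken over the rationals, the field over which the factorization is excluded; the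
   inclusion is then transported to [R]. *)
pose V : set 'rV[rat]_(1 + d) := [set v | exists p q,
  [/\ (0 < q)%N, q%:R <= Q, T (rational_point R p q) & v = map_mx intr (int_lift p q)]].
have [||r [M [rd VM]]] := @isotropic_span d rat (map_mx intr (A + A^T)) V _ _ (irreducible_no_factor qP irrP PE).
- by rewrite map_trmx linearD /= trmxK addrC.
- move=> _ _ [p1 [q1 [q10 q1Q T1 ->]]] [p2 [q2 [q20 q2Q T2 ->]]].
  have o := ortho _ _ _ _ _ q10 q20 q1Q q2Q (TP _ T1).1 (TP _ T2).1 (Tk _ _ T1 T2).
  by rewrite -(rmorph_bilform (intr : int -> rat)) o rmorph0.
pose W : 'M[R]_(r, 1 + d) := map_mx ratr M.
have TW z : T z -> (homogenize z <= W)%MS.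
  move=> Tz; have [_ [p [q [q0 qQ zE]]]] := TP z Tz.
  rewrite zE homogenize_rational//; apply: scalemx_sub.
  rewrite -(map_mx_intr (@ratr R)) map_submx; apply: VM.
  by exists p, q; split => //; rewrite -zE.
pose N : 'M[R]_(1 + d, d.-1) := col_mx (- (z0 *m D)) D.
have NE z : homogenize z *m N = (z - z0) *m D.
  by rewrite /homogenize /N mul_row_col mul1mx mulmxBl addrC.
have /submxP[c cE] := TW _ Tz0.
(* The first coordinate of a homogenized point is 1, so the lift of [z0] is a nonzero element of the
   span killed by [N]; this lowers the rank of [W *m N] below [r]. *)
have c0 : c != 0.
  apply/eqP => c0; move: cE; rewrite c0 mul0mx => /rowP/(_ (lshift d ord0))/eqP.
  by rewrite /homogenize row_mxEl !mxE eqxx oner_eq0.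
have cWN : c *m (W *m N) = 0 by rewrite mulmxA -cE NE subrr mul0mx.
have rkWN : (\rank (W *m N) < d.-1)%N.
  have rk : (\rank (W *m N) < r)%N.
    rewrite ltn_neqAle rank_leq_row andbT; apply/negP => fr.
    by move/eqP: c0; apply; apply/(row_free_inj fr); rewrite cWN mul0mx.
  by apply: leq_trans rk _; rewrite -ltnS (leq_trans rd)// leqSpred.
have [i ci] : exists i, col i (cokermx (W *m N)) != 0.
  apply/existsP; apply: contraLR rkWN; rewrite negb_exists => /forallP ck.
  rewrite -leqNgt -subn_eq0 -mxrank_coker mxrank_eq0; apply/eqP/matrixP => i j.
  by move: (ck j); rewrite negbK => /eqP/colP/(_ i); rewrite !mxE.
exists (col i (cokermx (W *m N))) => // z /TW/submxP[e eE].
rewrite -NE eE colE mulmxA -(mulmxA e) -(mulmxA e) mulmx_coker.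
by rewrite mulmx0 mul0mx.
Qed.

End Simplex.

(** * Covers by small balls *)

Section Packing.
Context {R : realType} {k : nat}.
Context (mu : {measure set (borel_row R k) -> \bar R}).

Lemma size_flatten_map_le (T : eqType) (f : T -> seq T) (s : seq T) (S : R) :
  (forall y, y \in s -> (size (f y))%:R <= S) ->
  (size (flatten (map f s)))%:R <= (size s)%:R * S.
Proof.
elim: s => [|y s IH] H /=; first by rewrite mul0r.
rewrite size_cat natrD -natr1 mulrDl mul1r addrC lerD//.
  by apply: IH => z zs; apply: H; rewrite inE zs orbT.
by apply: H; rewrite inE eqxx.
Qed.

Lemma open_measurable_row (V : set 'rV[R]_k) : open V ->
  measurable (V : set (borel_row R k)).
Proof. by move=> oV; apply: sub_sigma_algebra. Qed.

Lemma thickening_measurable (L : set 'rV[R]_k) (r : R) :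
  measurable (thickening L r : set (borel_row R k)).
Proof.
rewrite -[X in measurable X]setCK; apply: measurableC; apply: open_measurable_row.
have -> : ~` thickening L r = edist_inf L @^-1` [set y | (r%:E < y)%E].
  by apply/seteqP; split => y /=; rewrite /thickening /= ltNge => /negP.
apply: open_comp; last exact: open_ereal_gt_ereal.
by move=> y _; exact: edist_inf_continuous.
Qed.

Lemma le_mu (A B : set (borel_row R k)) : measurable A -> measurable B ->
  A `<=` B -> (mu A <= mu B)%E.
Proof. by move=> mA mB AB; apply: le_measure; rewrite ?inE. Qed.

(** Written as in [affine_hyperplane], so that [hyperplane_dot] holds by conversion. *)
Definition dot (a y : 'rV[R]_k) : R := \sum_(i < k) a ord0 i * y ord0 i.

Lemma dotB (a y z : 'rV[R]_k) : dot a (y - z) = dot a y - dot a z.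
Proof. by rewrite /dot -sumrB; apply: eq_bigr => i _; rewrite !mxE mulrBr. Qed.

Lemma dot_le (a y : 'rV[R]_k) : `|dot a y| <= k%:R * `|a| * `|y|.
Proof.
apply: le_trans (ler_norm_sum _ _ _) _.
apply: (@le_trans _ _ (\sum_(i < k) `|a| * `|y|)).
  by apply: ler_sum => i _; rewrite normrM ler_pM// rV_coord_le.
by rewrite sumr_const card_ord -[leLHS]mulr_natl mulrA.
Qed.

(* Correcting the coordinate where a is largest reaches the hyperplane. *)
Lemma slab_thickening (a y : 'rV[R]_k) (b t : R) : a != 0 ->
  `|dot a y - b| <= t * `|a| -> thickening [set y | dot a y = b] t y.
Proof.
move=> a0 H; have [i ai] : exists i, `|a| = `|a ord0 i|.
  have : mx_norm a != 0 by apply: contra_neq a0; exact: mx_norm_eq0.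
  by move=> /mx_norm_neq0 [[i j] /= aE]; exists j; rewrite (ord1 i) in aE.
have an : 0 < `|a| by rewrite normr_gt0.
have ai0 : a ord0 i != 0 by rewrite -normr_gt0 -ai.
pose s := (dot a y - b) / a ord0 i.
pose y' := y - s *: delta_mx ord0 i.
have dy' : dot a y' = b.
  rewrite dotB {2}/dot (bigD1 i)//= big1 ?addr0; last first.
    by move=> j ji; rewrite !mxE eqxx (negbTE ji) !mulr0.
  by rewrite !mxE !eqxx mulr1 /s mulrC divfK// subKr.
have st : `|s| <= t by rewrite /s normrM normfV -ai ler_pdivrMr.
have yy' : `|y - y'| <= `|s|.
  rewrite /y' subKr normrZ; apply: ler_piMr => //; apply: rV_norm_le => // j.
  by rewrite !mxE; case: (_ && _); rewrite ?normr1 ?normr0.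
rewrite /thickening /=; apply/lee_addgt0Pr => e e0.
apply: (@le_trans _ _ (edist (y, y'))); first by apply: ereal_inf_lbound; exists y'.
have te : 0 < t + e by rewrite ltr_wpDl// (le_trans _ st).
rewrite -EFinD; apply: edist_fin => //=; rewrite -ball_normE /=.
by apply: (le_lt_trans yy'); apply: (le_lt_trans st); rewrite ltrDl.
Qed.

Lemma hyperplane_dot (a : 'rV[R]_k) (b : R) : a != 0 ->
  affine_hyperplane [set y | dot a y = b].
Proof. by move=> a0; exists a, b. Qed.

(** Balls of radius [r / 2] about [r]-separated points are disjoint, so their masses add up. *)
Lemma separated_measure (r m : R) (l : seq 'rV[R]_k) :
  0 < r ->
  (forall y, y \in l -> (m%:E <= mu (ball y (r / 2)%R))%E) ->
  pairwise (fun x y => r <= `|x - y|) l ->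
  (((size l)%:R * m)%:E <= mu (\bigcup_(y in [set` l]) ball y (r / 2)%R))%E.
Proof.
move=> r0; elim: l => [|x l IH] Hm /=.
  by move=> _; rewrite mul0r measure_ge0.
move=> /andP[xl pl].
have mU : measurable (\bigcup_(y in [set` l]) ball y (r / 2) : set (borel_row R k)).
  by apply: open_measurable_row; apply: bigcup_open => y _; exact: ball_open.
have mB : measurable (ball x (r / 2) : set (borel_row R k)).
  by apply: open_measurable_row; exact: ball_open.
have -> : \bigcup_(y in [set` (x :: l)]) ball y (r / 2) =
    ball x (r / 2) `|` \bigcup_(y in [set` l]) ball y (r / 2).
  apply/seteqP; split => z /=.
    by move=> [y]; rewrite /= inE => /orP[/eqP ->|yl] yz; [left|right; exists y].
  by move=> [xz|[y yl yz]]; [exists x|exists y] => //=; rewrite inE ?eqxx ?yl ?orbT.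
rewrite measureU//; last first.
  rewrite -subset0 => z [xz [y /= yl yz]].
  have := allP xl _ yl; rewrite leNgt => /negP; apply.
  move: xz yz; rewrite -!ball_normE /= => xz yz.
  by rewrite (le_lt_trans (ler_distD z _ _))// [ltRHS]splitr ltrD// distrC.
rewrite -natr1 mulrDl mul1r addrC EFinD; apply: leeD.
  by apply: Hm; rewrite inE eqxx.
by apply: IH => // y yl; apply: Hm; rewrite inE yl orbT.
Qed.

(** Take a maximal [r]-separated list in [T]: the disjoint half-size balls inside [G] bound its
    length, and maximality makes the balls of radius [r] cover [T]. *)
Lemma packing_cover (r m M : R) (T : set 'rV[R]_k) (G : set (borel_row R k)) :
  0 < r -> 0 < m -> measurable G -> (mu G <= M%:E)%E ->
  (forall y, T y -> ball y (r / 2) `<=` G /\ (m%:E <= mu (ball y (r / 2)%R))%E) ->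
  exists l : seq 'rV[R]_k, [/\ forall y, y \in l -> T y,
    forall x, T x -> exists2 y, y \in l & ball y r x & (size l)%:R * m <= M].
Proof.
move=> r0 m0 mG GM HT.
pose Sep (l : seq 'rV[R]_k) := (forall y, y \in l -> T y) /\ pairwise (fun x y => r <= `|x - y|) l.
have bound l : Sep l -> (size l)%:R * m <= M.
  move=> [lT pl]; rewrite -lee_fin; apply: le_trans GM.
  apply: le_trans (separated_measure r0 _ pl) _.
    by move=> y /lT /HT[].
  apply: le_mu => //; last by move=> z [y /= /lT /HT[yG _]] /yG.
  by apply: open_measurable_row; apply: bigcup_open => y _; exact: ball_open.
pose Q n := `[< exists2 l, Sep l & size l = n >].
have Q0 : exists n, Q n.
  by exists 0%N; apply/asboolP; exists [::] => //; split.
have Qb n : Q n -> (n <= Num.truncn (M / m))%N.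
  move=> /asboolP[l /bound lM <-]; rewrite truncn_ge_nat ?ler_pdivlMr//.
  by rewrite mul0r (le_trans _ lM)// mulr_ge0 ?(ltW m0).
have [n /asboolP[l Sl <-] nmax] := ex_maxnP Q0 Qb.
exists l; split; [exact: Sl.1| |exact: bound].
move=> x Tx; apply: contrapT => Hx.
have : Q (size l).+1.
  apply/asboolP; exists (x :: l) => //; split.
    by move=> y; rewrite inE => /orP[/eqP ->//|]; exact: Sl.1.
  rewrite /= Sl.2 andbT; apply/allP => y yl; rewrite leNgt; apply/negP => xy.
  by apply: Hx; exists y => //; rewrite -ball_normE /= distrC.
by move=> /nmax; rewrite ltnn.
Qed.

(** * Covers of sets that are flat at successive scales *)

Section Scales.
Context (alpha delta rho0 Cd C : R).
Context (rho0_gt0 : 0 < rho0) (Cd_gt0 : 0 < Cd) (C_ge1 : 1 <= C).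
Context (decay : forall (rho : R) (x : 'rV[R]_k) (L : set 'rV[R]_k) (eps : R),
  0 < rho <= rho0 -> measure_support mu x -> affine_hyperplane L -> 0 < eps ->
  (mu (ball x rho `&` thickening L (eps * rho)) <=
     (Cd * eps `^ alpha)%:E * mu (ball x rho))%E).
Context (regular : forall (x : 'rV[R]_k) (rho : R),
  measure_support mu x -> 0 < rho <= rho0 ->
  ((C^-1 * rho `^ delta)%:E <= mu (ball x rho))%E /\
  (mu (ball x rho) <= (C * rho `^ delta)%:E)%E).

Let C_gt0 : 0 < C. Proof. exact: lt_le_trans C_ge1. Qed.

(** A ball of radius [eps * rho0] about [x] lies in a slab through [x]. Its mass is at least of
    order [eps^delta] by regularity and at most of order [eps^alpha] by decay; small [eps] forces
    [alpha <= delta]. The target dimension is therefore nonnegative. *)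
Lemma alpha_le_delta (x : 'rV[R]_k) : (0 < k)%N -> 0 < alpha ->
  measure_support mu x -> alpha <= delta.
Proof.
move=> k0 alpha0 xs; rewrite leNgt; apply/negP => da.
pose i : 'I_k := Ordinal k0; pose a : 'rV[R]_k := delta_mx ord0 i.
have a0 : a != 0.
  by apply/eqP => /rowP/(_ i)/eqP; rewrite !mxE !eqxx oner_eq0.
have key (eps : R) : 0 < eps -> eps <= 1 -> 1 <= C * C * Cd * eps `^ (alpha - delta).
  move=> e0 e1.
  have er : 0 < eps * rho0 <= rho0 by rewrite mulr_gt0//= ler_piMl// ltW.
  have rr : 0 < rho0 <= rho0 by rewrite rho0_gt0/=.
  have [lo _] := regular xs er; have [_ hi] := regular xs rr.
  have := decay rr xs (hyperplane_dot (dot a x) a0) e0.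
  set G := (X in mu X) => HG.
  have BG : (mu (ball x (eps * rho0)%R) <= mu G)%E.
    apply: le_mu.
    - by apply: open_measurable_row; exact: ball_open.
    - apply: measurableI; last exact: thickening_measurable.
      by apply: open_measurable_row; exact: ball_open.
    move=> y yb; split; first by apply: le_ball yb; case/andP: er.
    apply: slab_thickening => //; rewrite -dotB.
    have an : `|a| <= 1.
      by apply: rV_norm_le => // j; rewrite !mxE; case: (_ && _); rewrite ?normr1 ?normr0.
    have a1 : 1 <= `|a|.
      by apply: le_trans (rV_coord_le _ i); rewrite !mxE !eqxx normr1.
    have -> : `|a| = 1 by apply/eqP; rewrite eq_le an a1.
    rewrite mulr1 /dot (bigD1 i)//= big1 ?addr0; last first.
      by move=> j ji; rewrite !mxE eqxx (negbTE ji) mul0r.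
    rewrite [a _ _]mxE !eqxx mul1r; apply: le_trans (rV_coord_le _ i) _.
    by move: yb; rewrite -ball_normE /= distrC => /ltW.
  have : ((C^-1 * (eps * rho0) `^ delta)%:E <= (Cd * eps `^ alpha * (C * rho0 `^ delta))%:E)%E.
    apply: le_trans lo _; apply: le_trans BG _; apply: le_trans HG _.
    by rewrite [leRHS]EFinM; apply: lee_wpmul2l => //; rewrite lee_fin mulr_ge0 ?powR_ge0// ltW.
  rewrite lee_fin powRM ?(ltW e0) ?(ltW rho0_gt0)// => H.
  have rd : 0 < rho0 `^ delta by rewrite powR_gt0.
  have ed : 0 < eps `^ delta by rewrite powR_gt0.
  have ea : eps `^ (alpha - delta) = eps `^ alpha / eps `^ delta.
    by rewrite powRB// (gt_eqF e0) implybT.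
  rewrite ea mulrA ler_pdivlMr// mul1r.
  move: H; rewrite !mulrA ler_pM2r// => H.
  have := ler_wpM2l (ltW C_gt0) H; rewrite mulrA mulfV ?gt_eqF// mul1r.
  by move=> /le_trans; apply; rewrite le_eqVlt; apply/orP; left; apply/eqP; ring.
pose K := C * C * Cd.
have K0 : 0 < K by rewrite !mulr_gt0.
(* This makes [K * eps^(alpha - delta)] at most [1/2], contradicting [key]. *)
pose eps := Num.min 1 ((2 * K)^-1 `^ (alpha - delta)^-1).
have e0 : 0 < eps by rewrite lt_min ltr01 powR_gt0// invr_gt0 mulr_gt0.
have e1 : eps <= 1 by rewrite ge_min lexx.
have := key _ e0 e1; apply/negP; rewrite -ltNge -/K.
have ad : 0 < alpha - delta by rewrite subr_gt0.
have : eps `^ (alpha - delta) <= (2 * K)^-1.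
  apply: (@le_trans _ _ (((2 * K)^-1 `^ (alpha - delta)^-1) `^ (alpha - delta))).
    apply: ge0_ler_powR; rewrite ?nnegrE ?(ltW ad) ?(ltW e0) ?powR_ge0//.
    by rewrite ge_min lexx orbT.
  by rewrite -powRrM mulVf ?gt_eqF// powRr1// invr_ge0 mulr_ge0// ltW.
move=> /(ler_wpM2l (ltW K0)) /le_lt_trans; apply.
by rewrite invfM mulrCA mulfV ?gt_eqF// mulr1 invf_lt1// ltr1n.
Qed.

(** The factor [|a|] makes the condition invariant under rescaling [(a, b)]; by [slab_thickening] it
    places the points in the [t]-thickening of a hyperplane, which may vary with [x]. *)
Definition flat (E : set 'rV[R]_k) (r t : R) := forall x, E x ->
  exists2 a : 'rV[R]_k, a != 0 & exists b, forall u, E u -> ball x r u ->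
    `|dot a u - b| <= t * `|a|.

(** Here [(K + k) / 2] is the relative slab width at radius [2 r], up to [eps], and 4 is the ratio
    of the radii [2 r] and [eps r / 2], again up to [eps]. *)
Definition step_const (K : R) : R := C * C * Cd * ((K + k%:R) / 2) `^ alpha * 4 `^ delta.

(** Balls of radius [eps r / 2] about points of [E] near [x] lie in a slab inside [ball x (2 * r)].
    Decay bounds the mass of the slab by order [eps^alpha r^delta], each ball has mass at least of
    order [(eps r)^delta], and a packing argument gives the quotient. *)
Lemma flat_step (E : set 'rV[R]_k) (r eps K : R) (x : 'rV[R]_k) :
  E `<=` measure_support mu -> 0 < K -> 0 < r -> 2 * r <= rho0 -> 0 < eps <= 1 ->
  flat E r (K * (eps * r)) -> E x ->
  exists l : seq 'rV[R]_k, [/\ forall y, y \in l -> E y,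
    forall u, E u -> ball x r u -> exists2 y, y \in l & ball y (eps * r) u &
    (size l)%:R <= step_const K * eps `^ (alpha - delta)].
Proof.
move=> Es K0 r0 rr /andP[e0 e1] fl Ex.
have [a a0 [b Hab]] := fl x Ex.
have er0 : 0 < eps * r by rewrite mulr_gt0.
have er1 : eps * r <= r by rewrite ler_piMl// ltW.
pose T : set 'rV[R]_k := [set u | E u /\ ball x r u].
pose L := [set y | dot a y = b].
(* Moving by less than [eps r] changes [dot a] by at most [k |a| eps r], so the slab has half-width
   [(K + k) eps r], which equals [e' * (2 r)]. *)
pose e' := (K + k%:R) * eps / 2.
have Kk0 : 0 < K + k%:R by rewrite ltr_wpDr.
have e'0 : 0 < e' by rewrite divr_gt0// mulr_gt0.
pose G : set (borel_row R k) := ball x (2 * r) `&` thickening L (e' * (2 * r)).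
have r20 : 0 < 2 * r <= rho0 by rewrite mulr_gt0//=.
pose m := C^-1 * (eps * r / 2) `^ delta.
pose M := Cd * e' `^ alpha * (C * (2 * r) `^ delta).
have m0 : 0 < m by rewrite mulr_gt0 ?invr_gt0// powR_gt0// divr_gt0.
have mG : measurable G.
  apply: measurableI; last exact: thickening_measurable.
  by apply: open_measurable_row; exact: ball_open.
have GM : (mu G <= M%:E)%E.
  apply: le_trans (decay r20 (Es _ Ex) (hyperplane_dot b a0) e'0) _.
  rewrite /M [leRHS]EFinM; apply: lee_wpmul2l; first by rewrite lee_fin mulr_ge0 ?powR_ge0// ltW.
  exact: (regular (Es _ Ex) r20).2.
have [|l [lT lc lM]] := packing_cover er0 m0 mG GM (T := T).
  move=> y [Ey yb]; split; last first.
    apply: (regular (Es _ Ey) _).1; rewrite divr_gt0//=.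
    by apply: le_trans rr; lra.
  move=> u ub; move: yb (ub); rewrite -!ball_normE /= => yb ub'; split.
    rewrite -ball_normE /=; apply: le_lt_trans (ler_distD y _ _) _.
    by apply: lt_le_trans (ltrD yb ub') _; lra.
  apply: slab_thickening => //.
  have -> : dot a u - b = (dot a y - b) - dot a (y - u) by rewrite dotB; ring.
  apply: le_trans (ler_normB _ _) _.
  apply: le_trans (lerD (Hab y Ey _) (dot_le _ _)) _; first by rewrite -ball_normE.
  have : k%:R * `|a| * `|y - u| <= k%:R * `|a| * (eps * r).
    rewrite ler_wpM2l ?mulr_ge0//; apply: le_trans (ltW ub') _.
    by rewrite ler_pdivrMr// ler_peMr ?(ltW er0)// ler1n.
  move=> /(lerD (lexx (K * (eps * r) * `|a|))) /le_trans; apply.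
  by rewrite le_eqVlt; apply/orP; left; apply/eqP; rewrite /e'; field.
exists l; split; [by move=> y /lT[]|by move=> u Eu ub; exact: lc|].
move: lM; rewrite -ler_pdivlMr// => /le_trans; apply; rewrite le_eqVlt; apply/orP; left; apply/eqP.
have P1 : (eps * r / 2) `^ delta = eps `^ delta * (r / 2) `^ delta.
  by rewrite -powRM ?(ltW e0) ?divr_ge0 ?(ltW r0)// mulrA.
have P2 : (2 * r) `^ delta = 4 `^ delta * (r / 2) `^ delta.
  by rewrite -powRM ?divr_ge0 ?(ltW r0)//; congr (_ `^ _); field.
have P3 : e' `^ alpha = ((K + k%:R) / 2) `^ alpha * eps `^ alpha.
  by rewrite -powRM ?(ltW e0) ?divr_ge0 ?(ltW Kk0)//; congr (_ `^ _); rewrite /e'; field.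
rewrite /M /m P1 P2 P3 /step_const powRB; last by rewrite (gt_eqF e0) implybT.
have d1 : eps `^ delta != 0 by rewrite gt_eqF// powR_gt0.
have d2 : (r / 2) `^ delta != 0 by rewrite gt_eqF// powR_gt0// divr_gt0.
have d3 : C != 0 by rewrite gt_eqF.
by field; rewrite d1 d2 d3.
Qed.

Lemma flat_cover (E : set 'rV[R]_k) (r eps K : R) (x : 'rV[R]_k) (m : nat) :
  E `<=` measure_support mu -> 0 < K -> 0 < r -> 2 * r <= rho0 -> 0 < eps <= 1 ->
  (forall j, (j < m)%N -> flat E (eps ^+ j * r) (K * (eps ^+ j.+1 * r))) -> E x ->
  exists l : seq 'rV[R]_k, [/\ forall y, y \in l -> E y,
    forall u, E u -> ball x r u -> exists2 y, y \in l & ball y (eps ^+ m * r) u &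
    (size l)%:R <= (step_const K * eps `^ (alpha - delta)) ^+ m].
Proof.
move=> Es K0 r0 rr /andP[e0 e1] fl Ex; elim: m fl => [|m IH] fl.
  exists [:: x]; split; first by move=> y; rewrite inE => /eqP ->.
    by move=> u Eu ub; exists x; rewrite ?inE// expr0 mul1r.
  by rewrite expr0.
have [|l [lE lc ls]] := IH; first by move=> j jm; apply: fl; exact: ltnW.
set B := step_const K * _ in ls *.
have em0 : 0 < eps ^+ m * r by rewrite mulr_gt0 ?exprn_gt0.
have er2 : 2 * (eps ^+ m * r) <= rho0.
  apply: le_trans rr; rewrite ler_pM2l// ler_piMl ?(ltW r0)//.
  by rewrite exprn_ile1// ltW.
(* Stated as an implication for every [y], because [choice] needs a total relation. *)
have ch (y : 'rV[R]_k) : exists l' : seq 'rV[R]_k, E y -> [/\ forall z, z \in l' -> E z,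
    forall u, E u -> ball y (eps ^+ m * r) u -> exists2 z, z \in l' & ball z (eps ^+ m.+1 * r) u &
    (size l')%:R <= B].
  have [Ey|nEy] := pselect (E y); last by exists [::].
  have := @flat_step E (eps ^+ m * r) eps K y Es K0 em0 er2.
  have -> : eps * (eps ^+ m * r) = eps ^+ m.+1 * r by rewrite mulrA -exprS.
  rewrite e0 e1 => /(_ isT (fl m (ltnSn m)) Ey)[l' Hl'].
  by exists l'.
have [f Hf] := choice ch.
exists (flatten (map f l)); split.
- by move=> y /flattenP[_ /mapP[z zl ->]]; have [+ _ _] := Hf z (lE _ zl); apply.
- move=> u Eu ub; have [y yl yu] := lc u Eu ub.
  have [_ /(_ u Eu yu)[z zf zu] _] := Hf y (lE _ yl).
  by exists z => //; apply/flattenP; exists (f y) => //; exact: map_f.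
have B0 : 0 <= B by rewrite /B /step_const !mulr_ge0 ?powR_ge0// ltW.
have fB y : y \in l -> (size (f y))%:R <= B by move=> /lE /Hf[].
apply: le_trans (size_flatten_map_le fB) _.
by rewrite exprSr ler_wpM2r.
Qed.

(** Packing with regularity alone: the count down to the first scale [r] carries no gain from
    decay. *)
Lemma initial_cover (E : set 'rV[R]_k) (u0 : 'rV[R]_k) (r1 r : R) :
  E `<=` measure_support mu -> measure_support mu u0 -> E `<=` ball u0 r1 ->
  2 * r1 <= rho0 -> 0 < r <= r1 ->
  exists l : seq 'rV[R]_k, [/\ forall y, y \in l -> E y,
    forall u, E u -> exists2 y, y \in l & ball y r u &
    (size l)%:R <= C * C * 4 `^ delta * (r1 / r) `^ delta].
Proof.
move=> Es su0 E1 rr /andP[r0 rr1].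
have r10 : 0 < r1 by apply: lt_le_trans rr1.
pose m := C^-1 * (r / 2) `^ delta.
have m0 : 0 < m by rewrite mulr_gt0 ?invr_gt0// powR_gt0// divr_gt0.
have r20 : 0 < 2 * r1 <= rho0 by rewrite mulr_gt0//=.
have [||l [lT lc lM]] := @packing_cover r m _ E (ball u0 (2 * r1)) r0 m0 _ (regular su0 r20).2.
- by apply: open_measurable_row; exact: ball_open.
- move=> y Ey; split; last first.
    apply: (regular (Es _ Ey) _).1; rewrite divr_gt0//=.
    by apply: le_trans rr; lra.
  move=> u; move: (E1 _ Ey); rewrite -!ball_normE /= => yb ub.
  apply: le_lt_trans (ler_distD y _ _) _.
  by apply: lt_le_trans (ltrD yb ub) _; lra.
exists l; split => //.
move: lM; rewrite -ler_pdivlMr// => /le_trans; apply; rewrite le_eqVlt; apply/orP; left; apply/eqP.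
have -> : (2 * r1) `^ delta = 4 `^ delta * (r1 / r) `^ delta * (r / 2) `^ delta.
  rewrite -!powRM ?mulr_ge0 ?divr_ge0 ?invr_ge0 ?(ltW r0) ?(ltW r10)//.
  by congr (_ `^ _); field; rewrite gt_eqF.
have d2 : (r / 2) `^ delta != 0 by rewrite gt_eqF// powR_gt0// divr_gt0.
have d3 : C != 0 by rewrite gt_eqF.
by rewrite /m; field; rewrite d2 d3.
Qed.

Lemma flatW (E : set 'rV[R]_k) (r t t' : R) : t <= t' -> flat E r t -> flat E r t'.
Proof.
move=> tt fl x /fl[a a0 [b H]]; exists a => //; exists b => u Eu ub.
by apply: le_trans (H u Eu ub) _; rewrite ler_wpM2r.
Qed.

(* The scales rho, rho^(1+g), rho^(1+2g), ..., rho^c with g <= 1 are chosen so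
   that the quadratic error r^2 at one scale is at most the next scale. *)
Lemma scale_cover (c K r1 : R) : 1 <= c -> 0 < K -> 0 < r1 -> 2 * r1 <= rho0 ->
  exists2 A : R, 0 <= A & forall (E : set 'rV[R]_k) (u0 : 'rV[R]_k) (rho : R),
    E `<=` measure_support mu -> measure_support mu u0 -> E `<=` ball u0 r1 ->
    0 < rho <= r1 -> rho <= 1 ->
    (forall r, rho `^ c <= r <= rho -> flat E r (K * (rho `^ c + r ^+ 2))) ->
    exists l : seq 'rV[R]_k, [/\ forall y, y \in l -> E y,
      forall u, E u -> exists2 y, y \in l & ball y (rho `^ c) u &
      (size l)%:R <= A * rho `^ ((c - 1) * alpha - c * delta)].
Proof.
move=> c1 K0 r10 rr.
(* The number of steps [m] exceeds [c - 1], hence [g <= 1] and [rho <= rho^g], while [g * m = c - 1]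
   makes the last scale exactly [rho^c]. *)
pose m := (Num.truncn (c - 1)).+1; pose g := (c - 1) / m%:R.
have m0 : 0 < m%:R :> R by rewrite ltr0n.
have c0 : 0 <= c - 1 by rewrite subr_ge0.
have g0 : 0 <= g by rewrite divr_ge0// ltW.
have g1 : g <= 1 by rewrite ler_pdivrMr// mul1r ltW// truncnS_gt.
have gm : g * m%:R = c - 1 by rewrite divfK// gt_eqF.
pose B := step_const (2 * K).
have B0 : 0 <= B by rewrite /B /step_const !mulr_ge0 ?powR_ge0// ltW.
exists (C * C * 4 `^ delta * r1 `^ delta * B ^+ m).
  by rewrite !mulr_ge0 ?powR_ge0 ?exprn_ge0// ltW.
move=> E u0 rho Es su0 E1 /andP[rho_gt0 rho1] rho_le1 fl.
pose eps := rho `^ g.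
have e0 : 0 < eps by rewrite powR_gt0.
have e1 : eps <= 1.
  by rewrite -(powRr0 rho) ger_powR// rho_gt0.
have rho_eps : rho <= eps.
  by rewrite -{1}(powRr1 (ltW rho_gt0)) ger_powR// rho_gt0.
have epsX n : eps ^+ n = rho `^ (g * n%:R) by rewrite powRrM powR_mulrn// powR_ge0.
have tauE : eps ^+ m * rho = rho `^ c.
  rewrite epsX gm -{2}(powRr1 (ltW rho_gt0)) -powRD ?subrK//.
  by rewrite (gt_eqF rho_gt0) implybT.
have rr' : 2 * rho <= rho0 by apply: le_trans rr; rewrite ler_pM2l.
have [l0 [l0E l0c l0s]] := @initial_cover E u0 r1 rho Es su0 E1 rr (introT andP (conj rho_gt0 rho1)).
(* Both error terms are at most the next scale: [rho^c] is the last scale of all, and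
   [r^2 <= eps * r] because [r <= rho <= eps]. *)
have fl' j : (j < m)%N -> flat E (eps ^+ j * rho) (2 * K * (eps ^+ j.+1 * rho)).
  move=> jm; have ej0 : 0 < eps ^+ j by rewrite exprn_gt0.
  have tau_le : rho `^ c <= eps ^+ j.+1 * rho.
    by rewrite -tauE ler_pM2r// ler_wiXn2l// ltW.
  have ejr : eps ^+ j.+1 * rho <= eps ^+ j * rho.
    by rewrite ler_pM2r// exprS ler_piMl// ltW.
  apply: flatW (fl (eps ^+ j * rho) _); last first.
    rewrite (le_trans tau_le ejr)/= ler_piMl ?(ltW rho_gt0)//.
    by rewrite exprn_ile1// ltW.
  rewrite (mulrC 2 K) -mulrA ler_pM2l// mulr_natl mulr2n lerD//.
  rewrite expr2 mulrACA exprS mulrA ler_pM2r//.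
  apply: (@le_trans _ _ (eps ^+ j * 1 * rho)).
    by rewrite ler_pM2r// ler_pM2l// exprn_ile1// ltW.
  by rewrite mulr1 (mulrC eps) ler_pM2l.
have ch (y : 'rV[R]_k) : exists l' : seq 'rV[R]_k, E y -> [/\ forall z, z \in l' -> E z,
    forall u, E u -> ball y rho u -> exists2 z, z \in l' & ball z (rho `^ c) u &
    (size l')%:R <= (B * eps `^ (alpha - delta)) ^+ m].
  have [Ey|nEy] := pselect (E y); last by exists [::].
  have K20 : 0 < 2 * K by rewrite mulr_gt0.
  have [l' Hl'] := @flat_cover E rho eps (2 * K) y m Es K20 rho_gt0 rr' (introT andP (conj e0 e1)) fl' Ey.
  by exists l' => _; rewrite -tauE.
have [f Hf] := choice ch.
pose S := (B * eps `^ (alpha - delta)) ^+ m.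
have S0 : 0 <= S by rewrite exprn_ge0// mulr_ge0// powR_ge0.
exists (flatten (map f l0)); split.
- by move=> y /flattenP[_ /mapP[z zl ->]]; have [+ _ _] := Hf z (l0E _ zl); apply.
- move=> u Eu; have [y yl yu] := l0c u Eu.
  have [_ /(_ u Eu yu)[z zf zu] _] := Hf y (l0E _ yl).
  by exists z => //; apply/flattenP; exists (f y) => //; exact: map_f.
have fS y : y \in l0 -> (size (f y))%:R <= S by move=> /l0E /Hf[].
apply: le_trans (size_flatten_map_le fS) _.
apply: le_trans (ler_wpM2r S0 l0s) _.
rewrite le_eqVlt; apply/orP; left; apply/eqP.
(* The initial cover contributes [rho^(-delta)] and the [m] refinements together
   [rho^((c - 1)(alpha - delta))]. *)
have -> : (r1 / rho) `^ delta = r1 `^ delta * rho `^ (- delta).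
  rewrite powRM ?invr_ge0 ?(ltW r10) ?(ltW rho_gt0)//.
  by rewrite -[rho^-1]powR_inv1 ?(ltW rho_gt0)// -powRrM mulN1r.
have -> : S = B ^+ m * rho `^ ((c - 1) * (alpha - delta)).
  rewrite /S exprMn; congr (_ * _); rewrite -powR_mulrn ?powR_ge0// /eps -!powRrM -gm.
  by congr (_ `^ _); ring.
have -> : (c - 1) * alpha - c * delta = - delta + (c - 1) * (alpha - delta) by ring.
rewrite [in RHS]powRD; last by rewrite (gt_eqF rho_gt0) implybT.
by ring.
Qed.

End Scales.
End Packing.

(** * Flatness of the set of parameters close to rational points *)

Section ChartFlat.
Context {R : realType} {d : nat}.

Definition near_rational (P : mpoly d int) (psi : 'rV[R]_d.-1 -> 'rV[R]_d) (Q tau : R)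
    : set 'rV[R]_d.-1 :=
  [set u | exists p q, [/\ (0 < q)%N, q%:R <= Q, zero_locus P (rational_point R p q) &
     `|psi u - rational_point R p q| <= tau]].

Lemma dot_trmx (k : nat) (a : 'cV[R]_k) (y : 'rV[R]_k) : dot a^T y = (y *m a) ord0 ord0.
Proof. by rewrite /dot mxE; apply: eq_bigr => i _; rewrite mxE mulrC. Qed.

Lemma dotD (k : nat) (a y z : 'rV[R]_k) : dot a (y + z) = dot a y + dot a z.
Proof. by rewrite /dot -big_split; apply: eq_bigr => i _; rewrite !mxE mulrDr. Qed.

(** The inverse chart is used through a smooth extension [g] to an open set of the ambient space, so
    that it can be evaluated at rational points not known to lie in the image of the chart. Its
    derivative at one rational point [z0] is the matrix given to [rational_simplex]. *)
Lemma chart_flat (P : mpoly d int) (U : set 'rV[R]_d.-1) (M : set 'rV[R]_d)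
    (psi : 'rV[R]_d.-1 -> 'rV[R]_d) (u0 : 'rV[R]_d.-1) :
  quadratic P -> irreducible_over_rat P -> local_chart U M psi -> U u0 ->
  exists r1 L K kap : R, [/\ 0 < r1, 0 < L, 0 < K, 0 < kap &
    (forall u v, ball u0 r1 u -> ball u0 r1 v -> `|psi u - psi v| <= L * `|u - v|) /\
    forall (E : set 'rV[R]_d.-1) (Q tau r : R),
      E `<=` ball u0 r1 -> E `<=` near_rational P psi Q tau ->
      0 <= tau <= r -> 0 < r <= kap -> r * Q <= kap -> flat E r (K * (tau + r ^+ 2))].
Proof.
move=> qP irrP [oU smU _ [phi phiK sphi]] Uu0.
have [V [g [oV Vz0 smg gphi]]] := sphi (psi u0) (imageP _ Uu0).
have [eta [K2 [eta0 K20 tg]]] := taylor2 oV Vz0 (smg 2%N).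
have [r0 [L [r00 L0 tpsi]]] := taylor2 oU Uu0 (smU 2%N).
have [kappa kappa0 simp] := rational_simplex (R := R) qP irrP.
(* Keeps [psi u] within [eta / 2] of [psi u0]; rational points within another [eta / 2] remain where
   [g] is controlled. *)
pose r1 := Num.min r0 (eta / 2 / L).
have r10 : 0 < r1 by rewrite lt_min r00 !divr_gt0.
have sub1 u : ball u0 r1 u -> ball u0 r0 u.
  by apply: le_ball; rewrite ge_min lexx.
have lip u v : ball u0 r1 u -> ball u0 r1 v -> `|psi u - psi v| <= L * `|u - v|.
  by move=> /sub1 ub /sub1 vb; have [_ + _] := tpsi v vb; apply.
have psib u : ball u0 r1 u -> `|psi u0 - psi u| < eta / 2.
  move=> ub; have := lip u0 u (ballxx _ r10) ub => /le_lt_trans; apply.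
  rewrite mulrC -ltr_pdivlMr//; move: ub; rewrite -ball_normE /= => /lt_le_trans; apply.
  by rewrite ge_min lexx orbT.
(* Two rational points attached to parameters in [ball x r] are at distance at most
   [2 tau + L * (2 r)], hence at most [A * r]. *)
pose A := 2 + 2 * L.
have A0 : 0 < A by rewrite addr_gt0// mulr_gt0.
(* The first bound gives [tau <= r <= eta / 2]; the second gives [A * r * Q <= kappa]. *)
pose kap := Num.min (eta / 2) (kappa / A).
have kap0 : 0 < kap by rewrite lt_min !divr_gt0.
pose K := d.-1%:R * (K2 * (1 + A ^+ 2)) + 1.
have K0 : 0 < K by rewrite ltr_wpDl// !mulr_ge0 ?(ltW K20)// addr_ge0// exprn_ge0// ltW.
exists r1, L, K, kap; split => //; split => // E Q tau r E1 En /andP[tau0 taur] /andP[r_gt0 rk] rQ x Ex.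
have rk1 : r <= eta / 2 by apply: le_trans rk _; rewrite ge_min lexx.
have rk2 : A * (r * Q) <= kappa.
  rewrite mulrC -ler_pdivlMr//; apply: le_trans rQ _.
  by rewrite ge_min lexx orbT.
pose rat_near u z := [/\ zero_locus P z, exists p q, [/\ (0 < q)%N, q%:R <= Q & z = rational_point R p q] &
   `|psi u - z| <= tau].
pose T : set 'rV[R]_d := [set z | exists2 u, E u /\ ball x r u & rat_near u z].
have near_ex u : E u -> exists z, rat_near u z.
  by move=> /En[p [q [q0 qQ Zr h]]]; exists (rational_point R p q); split => //; exists p, q.
have Q0 : 0 <= Q.
  by have [p [q [_ qQ _ _]]] := En _ Ex; apply: le_trans qQ.
have TT z w : T z -> T w -> `|z - w| <= A * r.
  move=> [u [Eu ub] [_ _ hz]] [v [Ev vb] [_ _ hw]].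
  have uv : `|u - v| <= 2 * r.
    move: ub vb; rewrite -!ball_normE /= => ub vb.
    have := ler_distD x u v; rewrite (distrC u x) => h; apply: (le_trans h); lra.
  have luv : `|psi u - psi v| <= L * (2 * r).
    by apply: le_trans (lip _ _ (E1 _ Eu) (E1 _ Ev)) _; rewrite ler_pM2l.
  have -> : z - w = (psi u - psi v) - (psi u - z) + (psi v - w).
    by apply/rowP => i; rewrite !mxE; ring.
  apply: le_trans (ler_normD _ _) _; apply: le_trans (lerD (ler_normB _ _) hw) _.
  by rewrite /A; lra.
have Tb z u : E u -> rat_near u z -> ball (psi u0) eta z.
  move=> Eu [_ _ hz]; rewrite -ball_normE /=.
  apply: le_lt_trans (ler_distD (psi u) _ _) _.
  have := psib _ (E1 _ Eu); lra.
have Tx : exists z, T z.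
  have [z hz] := near_ex _ Ex; exists z; exists x => //; split => //.
  exact: ballxx.
have [z0 Tz0] := Tx.
have z0b : ball (psi u0) eta z0 by case: Tz0 => u [Eu _] /(Tb _ _ Eu).
have [_ _ [D HD]] := tg z0 z0b.
have [||a a0 Ha] := simp Q T _ _ z0 Tz0 D.
- by move=> z [u _ []].
- move=> z w Tz Tw; apply: le_trans rk2; rewrite mulrA.
  by apply: ler_wpM2r => //; exact: TT.
exists a^T; first by rewrite trmx_eq0.
exists (dot a^T (g z0)) => u Eu ub; rewrite -dotB.
have [z hz] := near_ex _ Eu.
have Tz : T z by exists u.
have zb := Tb _ _ Eu hz.
have pub : ball (psi u0) eta (psi u).
  by rewrite -ball_normE /=; have := psib _ (E1 _ Eu); lra.
have Uu : U u by have [] := tpsi u (sub1 _ (E1 _ Eu)).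
have uE : g (psi u) = u.
  by rewrite gphi ?phiK//; have [] := tg _ pub.
(* The three terms are of order [tau] by the Lipschitz bound, of order [r^2] by Taylor, and
   orthogonal to [a] by the choice of [a]. *)
have -> : u - g z0 = (g (psi u) - g z) + (g z - g z0 - (z - z0) *m D) + (z - z0) *m D.
  by rewrite uE; move: ((z - z0) *m D) => X; apply/rowP => i; rewrite !mxE; ring.
have X1 : `|g (psi u) - g z| <= K2 * tau.
  have [_ lg _] := tg z zb; apply: le_trans (lg _ pub) _; rewrite ler_pM2l//.
  by case: hz.
have X2 : `|g z - g z0 - (z - z0) *m D| <= K2 * (A * r) ^+ 2.
  apply: le_trans (HD _ zb) _; rewrite ler_pM2l// lerXn2r ?nnegrE//.
    by rewrite mulr_ge0// ltW.
  exact: TT.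
rewrite dotD [X in _ + X]dot_trmx Ha// [X in _ + X]mxE addr0.
apply: le_trans (dot_le _ _) _.
have X12 := le_trans (ler_normD _ _) (lerD X1 X2).
apply: le_trans (ler_wpM2l _ X12) _; first by rewrite mulr_ge0.
rewrite mulrAC ler_wpM2r//.
have r2 : 0 <= r ^+ 2 by rewrite exprn_ge0// ltW.
apply: (@le_trans _ _ (d.-1%:R * (K2 * (1 + A ^+ 2)) * (tau + r ^+ 2))); last first.
  by rewrite /K [leRHS]mulrDl mul1r lerDl addr_ge0.
rewrite -mulrA ler_wpM2l// -mulrDr -mulrA ler_pM2l// exprMn.
have A20 : 0 <= A ^+ 2 by rewrite exprn_ge0// ltW.
have := mulr_ge0 A20 tau0; lra.
Qed.

End ChartFlat.

(** * Hausdorff measure *)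

Section Hausdorff.
Context {R : realType} {d : nat}.
Implicit Types (A : set 'rV[R]_d) (s eps : R).

Lemma diameter_ge0 A : (0 <= diameter A)%E.
Proof. by apply: ereal_sup_ubound; left. Qed.

Lemma diameter_le A (r : R) : 0 <= r ->
  (forall x y, A x -> A y -> `|x - y| <= r) -> (diameter A <= r%:E)%E.
Proof.
move=> r0 H; apply: ge_ereal_sup => _ [->|[[x y] [/= Ax Ay] <-]].
  by rewrite lee_fin.
by rewrite lee_fin; exact: H.
Qed.

Lemma diameter_set0 : diameter (set0 : set 'rV[R]_d) = 0%E.
Proof.
apply/eqP; rewrite eq_le diameter_ge0 andbT.
by apply: diameter_le.
Qed.

Lemma hausdorff_premeasure_ge0 s eps A : (0 <= hausdorff_premeasure s eps A)%E.
Proof.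
apply: le_ereal_inf_tmp => _ [F _ <-].
by apply: nneseries_ge0 => n _ _; exact: poweR_ge0.
Qed.

Lemma hausdorff_premeasure_mono s eps A B : A `<=` B ->
  (hausdorff_premeasure s eps A <= hausdorff_premeasure s eps B)%E.
Proof.
move=> AB; apply: le_ereal_inf_tmp => _ [F [BF Fd] <-]; apply: ereal_inf_lbound.
by exists F => //; split => //; exact: subset_trans BF.
Qed.

(** Near-optimal covers with excess [e / 2^(n+1)] are merged along a bijection of [nat] with pairs.
    They exist only for finite infima, so an infinite term is treated first. *)
Lemma hausdorff_premeasure_bigcup s eps (A : nat -> set 'rV[R]_d) :
  (hausdorff_premeasure s eps (\bigcup_n A n) <=
     \sum_(0 <= n <oo) hausdorff_premeasure s eps (A n))%E.
Proof.
have [[i ioo]|] := pselect (exists i, hausdorff_premeasure s eps (A i) = +oo%E).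
  rewrite (eseries_pinfty _ _ ioo) ?leey// => n _.
  by rewrite -ltNye (lt_le_trans _ (hausdorff_premeasure_ge0 _ _ _)).
rewrite -forallNE => Aoo.
apply/lee_addgt0Pr => e e0.
rewrite (le_trans _ (epsilon_trick _ _ (ltW e0)))//; last first.
  by move=> n; exact: hausdorff_premeasure_ge0.
pose Q n (F : nat -> set 'rV[R]_d) :=
  (A n `<=` \bigcup_i F i /\ forall i, (diameter (F i) <= eps%:E)%E) /\
  (\sum_(0 <= i <oo) diameter (F i) `^ s <=
     hausdorff_premeasure s eps (A n) + (e / (2 ^ n.+1)%:R)%:E)%E.
have [G QG] : {G : nat -> nat -> set 'rV[R]_d & forall n, Q n (G n)}.
  apply: (@choice _ _ Q) => n.
  have e2 : 0 < e / (2 ^ n.+1)%:R by rewrite divr_gt0// ltr0n expn_gt0.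
  have fin : hausdorff_premeasure s eps (A n) \is a fin_num.
    rewrite ge0_fin_numE ?hausdorff_premeasure_ge0// ltey; exact/eqP/Aoo.
  have [_ [F HF <-] /ltW Fe] := lb_ereal_inf_adherent e2 fin.
  by exists F.
have g0 (x : nat * nat) : (0 <= diameter (G x.1 x.2) `^ s)%E by exact: poweR_ge0.
apply: (@le_trans _ _ (\sum_(0 <= n <oo) \sum_(0 <= i <oo) diameter (G n i) `^ s)%E); last first.
  apply: lee_nneseries => n _; last exact: (QG n).2.
  by move=> _; apply: nneseries_ge0 => i _ _; exact: poweR_ge0.
rewrite nneseries_esumT; last by move=> n; apply: nneseries_ge0 => i _ _; exact: poweR_ge0.
rewrite (eq_esum (b := fun n => \esum_(i in [set: nat]) (diameter (G n i) `^ s)%E)); last first.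
  by move=> n _; rewrite nneseries_esumT// => i; exact: poweR_ge0.
rewrite esum_esum//; last by move=> i j _ _; exact: poweR_ge0.
have /card_esym/ppcard_eqP[f] := card_nat2.
apply: ereal_inf_lbound; exists (fun k => G (f k).1 (f k).2).
  split; last by move=> i; exact: (QG (f i).1).1.2.
  move=> x [n _ /(QG n).1.1 [i _ Gx]].
  by exists (f^-1%FUN (n, i)) => //; rewrite invK ?inE.
rewrite nneseries_esumT; last by move=> n; exact: g0.
rewrite (reindex_esum setT ([set: nat] `*`` (fun=> [set: nat])) f)//.
have -> : [set: nat] `*`` (fun=> [set: nat]) = [set: nat * nat] by apply/seteqP; split.
exact: 'bij_f.
Qed.

Lemma hausdorff_premeasure_seq s eps (r : R) A (l : seq (set 'rV[R]_d)) :
  0 < s -> 0 <= r <= eps -> (forall x, A x -> exists2 F, F \in l & F x) ->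
  (forall F, F \in l -> (diameter F <= r%:E)%E) ->
  (hausdorff_premeasure s eps A <= ((size l)%:R * r `^ s)%:E)%E.
Proof.
(* Past the end of [l] the cover consists of empty sets, which have diameter 0 and cost nothing
   since [s > 0]. *)
move=> s0 /andP[r0 reps] Al dl; pose F i := nth set0 l i.
have dF i : (diameter (F i) <= r%:E)%E.
  have [il|il] := ltnP i (size l); first by apply: dl; exact: mem_nth.
  by rewrite /F nth_default// diameter_set0 lee_fin.
apply: (@le_trans _ _ (\sum_(0 <= i <oo) diameter (F i) `^ s)%E).
  apply: ereal_inf_lbound; exists F => //; split.
    move=> x /Al[B Bl Bx]; exists (index B l) => //.
    by rewrite /F nth_index.
  by move=> i; apply: le_trans (dF i) _; rewrite lee_fin.
rewrite (nneseries_split 0 (size l)); last by move=> k _; exact: poweR_ge0.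
rewrite add0n eseries0 ?adde0; last first.
  by move=> i il _; rewrite /F nth_default// diameter_set0 poweR0r ?gt_eqF.
apply: (@le_trans _ _ (\sum_(0 <= i < size l) (r `^ s)%:E)%E).
  apply: lee_sum => i _; rewrite -poweR_EFin.
  apply: gt0_ler_poweR => //; rewrite ?(ltW s0)// in_itv/= leey andbT ?diameter_ge0//.
by rewrite sumEFin sumr_const_nat subn0 mulr_natl.
Qed.

Lemma hausdorff_nullP s A :
  (forall eps, 0 < eps -> hausdorff_premeasure s eps A = 0%E) ->
  hausdorff_measure s A = 0%E.
Proof.
move=> H; apply/eqP; rewrite eq_le; apply/andP; split.
  by apply: ge_ereal_sup => _ [eps eps0 <-]; rewrite H.
apply: (@le_trans _ _ (hausdorff_premeasure s 1 A)).
  exact: hausdorff_premeasure_ge0.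
by apply: ereal_sup_ubound; exists 1 => //=.
Qed.

Lemma hausdorff_null_premeasure s A eps : hausdorff_measure s A = 0%E ->
  0 < eps -> hausdorff_premeasure s eps A = 0%E.
Proof.
move=> H eps0; apply/eqP; rewrite eq_le hausdorff_premeasure_ge0 andbT -H.
by apply: ereal_sup_ubound; exists eps.
Qed.

Lemma hausdorff_null_subset s A B : A `<=` B -> hausdorff_measure s B = 0%E ->
  hausdorff_measure s A = 0%E.
Proof.
move=> AB B0; apply: hausdorff_nullP => eps eps0; apply/eqP.
rewrite eq_le hausdorff_premeasure_ge0 andbT -(hausdorff_null_premeasure B0 eps0).
exact: hausdorff_premeasure_mono.
Qed.

Lemma hausdorff_null_bigcup s (A : nat -> set 'rV[R]_d) :
  (forall n, hausdorff_measure s (A n) = 0%E) ->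
  hausdorff_measure s (\bigcup_n A n) = 0%E.
Proof.
move=> H; apply: hausdorff_nullP => eps eps0; apply/eqP.
rewrite eq_le hausdorff_premeasure_ge0 andbT.
apply: le_trans (hausdorff_premeasure_bigcup _ _ _) _.
by rewrite eseries0// => n _ _; rewrite hausdorff_null_premeasure.
Qed.

Lemma nneseries_geometric (a x : R) : 0 <= x < 1 ->
  (\sum_(0 <= n <oo) (a * x ^+ n)%:E = (a / (1 - x))%:E)%E.
Proof.
move=> /andP[x0 x1]; apply: cvg_lim => //.
under eq_fun do rewrite sumEFin.
apply: cvg_EFin; first by near=> n.
by apply: cvg_geometric_series; rewrite ger0_norm.
Unshelve. all: by end_near. Qed.

(** The Borel-Cantelli argument: [A] is covered by every tail of [B], and the tails of a geometric
    series tend to 0. *)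
Lemma hausdorff_null_limsup s A (B : nat -> set 'rV[R]_d) (C x : R) :
  0 <= C -> 0 <= x < 1 ->
  (forall N, A `<=` \bigcup_n B (N + n)%N) ->
  (forall eps, 0 < eps -> exists N, forall n, (N <= n)%N ->
     (hausdorff_premeasure s eps (B n) <= (C * x ^+ n)%:E)%E) ->
  hausdorff_measure s A = 0%E.
Proof.
move=> C0 /andP[x0 x1] AB HB; apply: hausdorff_nullP => eps eps0; apply/eqP.
rewrite eq_le hausdorff_premeasure_ge0 andbT.
have [N0 HN0] := HB eps eps0.
apply/lee_addgt0Pr => e e0; rewrite add0e.
have cv : (fun n => C / (1 - x) * x ^+ n) @ \oo --> (0 : R).
  by rewrite -(mulr0 (C / (1 - x))); apply: cvgMr; apply: cvg_expr; rewrite ger0_norm.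
have /cvgr_dist_lt/(_ e e0)[N1 _ HN1] := cv.
pose N := maxn N0 N1.
apply: le_trans (hausdorff_premeasure_mono _ _ (AB N)) _.
apply: le_trans (hausdorff_premeasure_bigcup _ _ _) _.
apply: (@le_trans _ _ (\sum_(0 <= n <oo) (C * x ^+ N * x ^+ n)%:E)%E).
  apply: lee_nneseries => n _; first by move=> _; exact: hausdorff_premeasure_ge0.
  rewrite -mulrA -exprD; apply: HN0.
  by rewrite (leq_trans (leq_maxl N0 N1))// leq_addr.
rewrite nneseries_geometric ?x0// lee_fin.
have := HN1 N (leq_maxr _ _); rewrite /= sub0r normrN => /ltW.
apply: le_trans; rewrite mulrAC; exact: ler_norm.
Qed.

Lemma hausdorff_dim_le A (b : R) : 0 <= b ->
  (forall s, b < s -> hausdorff_measure s A = 0%E) -> (hausdorff_dim A <= b%:E)%E.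
Proof.
move=> b0 H; apply/lee_addgt0Pr => e e0.
apply: ereal_inf_lbound; exists (b + e) => //=; split.
  by rewrite ltr_wpDl.
by apply: H; rewrite ltrDl.
Qed.

End Hausdorff.

(** * Countable decompositions *)

Section Approximation.
Context {R : realType} {d : nat}.

Lemma finite_bounded_rationals (x : 'rV[R]_d) (C : R) (N : nat) :
  finite_set [set r | exists p q, [/\ (0 < q)%N, (q < N)%N, r = rational_point R p q &
    `|x - r| <= C]].
Proof.
pose B := (Num.truncn (N%:R * (`|x| + C))).+1.
(* Numerators between [-B] and [B] are encoded by ordinals below [2 B + 1], shifted by [B]. *)
pose f (t : 'I_N * {ffun 'I_d -> 'I_(2 * B).+1}) : 'rV[R]_d :=
  rational_point R (\row_i ((t.2 i : nat)%:Z - B%:Z)) t.1.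
apply: (sub_finite_set (B := f @` setT)); last first.
  by apply: finite_image; exact: finite_finset.
move=> _ [p [q [q0 qN -> H]]].
have q0' : 0 < q%:R :> R by rewrite ltr0n.
have pB i : (`|p ord0 i| <= B%:Z)%R.
  have : `|(p ord0 i)%:~R| <= N%:R * (`|x| + C) :> R.
    have -> : (p ord0 i)%:~R = q%:R * (rational_point R p q ord0 i).
      by rewrite mxE mulrC divfK// gt_eqF.
    rewrite normrM ger0_norm//; apply: ler_pM => //.
      by rewrite ler_nat ltnW.
    apply: le_trans (rV_coord_le _ i) _.
    rewrite -[rational_point _ _ _](subrK x) addrC.
    by apply: le_trans (ler_normD _ _) _; rewrite lerD2l distrC.
  move=> /le_lt_trans /(_ (truncnS_gt _)).
  rewrite -intr_norm => h.
  have : (`|p ord0 i|%:~R : R) < B%:Z%:~R by [].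
  by rewrite ltr_int => /ltW.
have pB' i : (absz (p ord0 i + B%:Z)%R < (2 * B).+1)%N.
  have := pB i; move: (p ord0 i) => z; rewrite ler_norml => /andP[zl zr].
  have z0 : 0 <= z + B%:Z by rewrite -lerBlDr sub0r.
  rewrite ltnS -lez_nat gez0_abs//.
  by rewrite mul2n -addnn PoszD lerD2r.
exists (Ordinal qN, [ffun i => Ordinal (pB' i)]) => //.
rewrite /f /=; congr (rational_point R _ _); apply/rowP => i; rewrite mxE ffunE /=.
rewrite gez0_abs ?addrK//.
by have := pB i; rewrite ler_norml => /andP[zl _]; rewrite -lerBlDr sub0r.
Qed.

(** Only finitely many points near [x] have bounded denominator, so denominators of good points are
    unbounded. Lowering the exponent slightly absorbs [C] for large [q]; the lowered exponents
    [c + 1/(j+1)] form a countable family. *)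
Lemma omega_gt_approx (Z : set 'rV[R]_d) (x : 'rV[R]_d) (c : R) : 0 <= c ->
  (c%:E < omega Z x)%E ->
  exists j : nat, forall N : nat, exists p q,
    [/\ (N <= q)%N, (0 < q)%N, Z (rational_point R p q) &
      `|x - rational_point R p q| <= q%:R `^ (- (c + j.+1%:R^-1))].
Proof.
move=> c0 /ereal_sup_gt [_ [c' [c'0 [C C0 inf]] <-]]; rewrite lte_fin => cc'.
pose j := Num.truncn (c' - c)^-1.
have jlt : j.+1%:R^-1 < c' - c.
  rewrite -[ltRHS]invrK ltf_pV2 ?posrE ?ltr0n ?invr_gt0 ?subr_gt0//.
  exact: truncnS_gt.
exists j => N; set c1 := c + _.
have e0 : 0 < c' - c1 by rewrite /c1 opprD addrA subr_gt0.
(* Beyond this threshold [C <= q^(c' - c1)]. *)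
pose N2 := maxn N (Num.truncn (C `^ (c' - c1)^-1)).+1.
apply: contrapT => H; apply: inf.
apply: sub_finite_set (finite_bounded_rationals x C N2.+1) => r [Zr [p [q [[q0 _] rE hr]]]].
have q1 : 1 <= q%:R :> R by rewrite ler1n.
exists p, q; split => //; last first.
  apply: le_trans hr _; rewrite ler_piMr ?(ltW C0)//.
  have c'N : - c' <= 0 by rewrite oppr_le0 ltW.
  by have := ler_powR q1 c'N; rewrite powRr0.
rewrite ltnS leqNgt; apply/negP => N2q; apply: H; exists p, q; split => //.
- by apply: leq_trans (ltnW N2q); rewrite leq_maxl.
- by rewrite -rE.
rewrite -rE; apply: le_trans hr _.
have -> : - c1 = (c' - c1) + - c' by ring.
have qp : 0 < q%:R :> R by rewrite ltr0n.
rewrite powRD; last by rewrite (gt_eqF qp) implybT.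
rewrite ler_pM2r ?powR_gt0//.
have Cq : C `^ (c' - c1)^-1 <= q%:R.
  apply: ltW; apply: lt_le_trans (truncnS_gt _) _; rewrite ler_nat.
  by apply: leq_trans (ltnW N2q); rewrite leq_maxr.
have -> : C = (C `^ (c' - c1)^-1) `^ (c' - c1).
  by rewrite -powRrM mulVf ?gt_eqF// powRr1// ltW.
by apply: ge0_ler_powR => //; rewrite ?nnegrE ?powR_ge0 ?(ltW e0)// ltW.
Qed.

Lemma rat_dense_row (k : nat) (x : 'rV[R]_k) (e : R) : 0 < e ->
  exists w : 'rV[rat]_k, ball x e (map_mx ratr w).
Proof.
move=> e0.
have H (i : 'I_k) : exists q : rat, `|x ord0 i - ratr q| < e / 2.
  have [|q] := @rat_in_itvoo R (x ord0 i - e / 2) (x ord0 i + e / 2).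
    by rewrite ltrD2l gt0_cp// divr_gt0.
  by rewrite in_itv /= => /andP[q1 q2]; exists q; rewrite ltr_distlC q1.
have [f Hf] := choice H; exists (\row_i f i).
rewrite -ball_normE /=; apply: (@le_lt_trans _ _ (e / 2)); last by lra.
by apply: rV_norm_le => [|i]; [rewrite divr_ge0// ltW|rewrite !mxE ltW].
Qed.

(* The balls with rational centre and radius 1 / (n + 1) form a countable base. *)
Lemma sigma_ideal_local (k : nat) (I : set (set 'rV[R]_k)) (X : set 'rV[R]_k) :
  I set0 -> (forall A B, A `<=` B -> I B -> I A) ->
  (forall F : nat -> set 'rV[R]_k, (forall n, I (F n)) -> I (\bigcup_n F n)) ->
  (forall x, X x -> exists2 r, 0 < r & I (X `&` ball x r)) -> I X.
Proof.
move=> I0 Isub Icup H.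
pose G (t : 'rV[rat]_k * nat) : set 'rV[R]_k :=
  X `&` ball (map_mx ratr t.1 : 'rV[R]_k) t.2.+1%:R^-1.
(* Codes that decode to nothing, or to a ball whose trace is not in [I], give the empty set, so
   every [F n] is in [I]. *)
pose F (n : nat) : set 'rV[R]_k := if unpickle n is Some t then
  (if pselect (I (G t)) then G t else set0) else set0.
have IF n : I (F n).
  by rewrite /F; case: unpickle => // t; case: pselect.
apply: (Isub _ _ _ (Icup F IF)) => x Xx.
have [r r0 Ir] := H x Xx.
pose n := Num.truncn (r / 2)^-1.
have nr : n.+1%:R^-1 < r / 2.
  rewrite -[ltRHS]invrK ltf_pV2 ?posrE ?ltr0n ?invr_gt0 ?divr_gt0//.
  exact: truncnS_gt.
have n0 : 0 < n.+1%:R^-1 :> R by rewrite invr_gt0 ltr0n.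
have [w xw] := rat_dense_row x n0.
exists (pickle (w, n)) => //; rewrite /F pickleK.
have IG : I (G (w, n)).
  apply: (Isub _ _ _ Ir) => y [Xy yb]; split => //.
  move: xw yb; rewrite -!ball_normE /= => xw yb.
  apply: le_lt_trans (ler_distD (map_mx ratr w) _ _) _.
  by apply: lt_trans (ltrD xw yb) _; rewrite [ltRHS]splitr ltrD.
case: pselect => //= IG'; split => //=.
by move: xw; rewrite -!ball_normE /= distrC.
Qed.

End Approximation.

(** * Supports, and local vanishing of the Hausdorff measure *)

Section LocalNull.
Context {R : realType} {d : nat}.

(** The local extension [g] of the inverse chart is continuous, so a neighbourhood [W] of [u]
    contains the preimage of a neighbourhood of [psi u], which has positive mass. *)
Lemma chart_support (mu : {measure set (borel_row R d.-1) -> \bar R})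
    (U : set 'rV[R]_d.-1) (M : set 'rV[R]_d) (psi : 'rV[R]_d.-1 -> 'rV[R]_d) :
  local_chart U M psi ->
  support_in (psi @` U) (chart_pushforward mu U psi) `<=` psi @` measure_support mu.
Proof.
move=> [oU smU _ [phi phiK sphi]] _ [[u Uu <-] HV]; exists u => //; split => // W oW Wu.
have [V [g [oV Vz0 smg gphi]]] := sphi (psi u) (imageP _ Uu).
have gu : g (psi u) = u by rewrite gphi ?phiK.
have : nbhs (psi u) (V `&` g @^-1` W).
  apply: filterI; first exact: open_nbhs_nbhs.
  apply: ((smg 0%N).1 (psi u) Vz0); rewrite gu; exact: open_nbhs_nbhs.
rewrite nbhsE => -[V' [oV' V'u] V'VW].
apply: lt_le_trans (HV V' oV' V'u) _; rewrite /chart_pushforward.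
apply: le_mu; last first.
- by move=> y [Uy V'y]; have [Vy Wy] := V'VW _ V'y; rewrite -(phiK y Uy) -gphi.
- exact: open_measurable_row.
apply: open_measurable_row; rewrite openE => y [Uy V'y]; apply: filterI.
  exact: open_nbhs_nbhs.
by apply: ((smU 0%N).1 y Uy); exact: open_nbhs_nbhs.
Qed.

(** Otherwise every point has a null neighbourhood, and the countable base makes the whole space
    null. *)
Lemma support_neq0 (k : nat) (mu : {measure set (borel_row R k) -> \bar R}) :
  mu setT <> 0%E -> exists u, measure_support mu u.
Proof.
move=> mu0; apply: contrapT => Hno; apply: mu0.
have : mu.-negligible (setT : set (borel_row R k)).
  apply: (@sigma_ideal_local R k (fun A => mu.-negligible (A : set (borel_row R k)))).
  - exact: negligible_set0.
  - by move=> A B AB [N [mN N0 BN]]; exists N; split => //; exact: subset_trans BN.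
  - by move=> F HF; exact: (@negligible_bigcup _ (borel_row R k) R mu F).
  move=> x _; have : ~ measure_support mu x by move=> xs; apply: Hno; exists x.
  move=> /not_andP[/(_ I)//|/existsNP[V /not_implyP[oV /not_implyP[Vx /negP]]]].
  rewrite -leNgt => V0.
  have : nbhs x V by exact: open_nbhs_nbhs.
  move=> /nbhs_ballP[r /= r0 rV]; exists r => //.
  exists V; split; [exact: open_measurable_row|apply/eqP|by move=> y [_ /rV]].
  by rewrite eq_le V0 measure_ge0.
move=> [B [mB B0 TB]]; suff -> : setT = B by [].
by apply/seteqP; split.
Qed.

Lemma two_powRN_lt1 (x : R) : 0 < x -> 2 `^ (- x) < 1.
Proof.
move=> x0; rewrite /powR pnatr_eq0 /= expR_lt1 mulNr oppr_lt0 mulr_gt0//.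
by rewrite ln_gt0// ltr1n.
Qed.

Lemma expr_small (t e : R) : 0 <= t < 1 -> 0 < e ->
  exists N, forall n, (N <= n)%N -> t ^+ n <= e.
Proof.
move=> /andP[t0 t1] e0.
have cv : (fun n => t ^+ n) @ \oo --> (0 : R) by apply: cvg_expr; rewrite ger0_norm.
have /cvgr_dist_le/(_ e e0)[N _ HN] := cv; exists N => n Nn.
by have := HN n Nn; rewrite /= sub0r normrN => /(le_trans (ler_norm _)).
Qed.

(** Dyadic blocks of denominators are treated separately: [chart_flat] makes each set [E n] flat,
    [scale_cover] covers it, and the costs decay geometrically in [n]. *)
Lemma local_null (P : mpoly d int) (alpha delta rho0 Cd C : R)
    (mu : {measure set (borel_row R d.-1) -> \bar R})
    (U : set 'rV[R]_d.-1) (M : set 'rV[R]_d) (psi : 'rV[R]_d.-1 -> 'rV[R]_d)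
    (c c1 s : R) (u0 : 'rV[R]_d.-1) :
  quadratic P -> irreducible_over_rat P ->
  0 < rho0 -> 0 < Cd -> 1 <= C ->
  (forall (rho : R) (x : 'rV[R]_d.-1) (L : set 'rV[R]_d.-1) (eps : R),
    0 < rho <= rho0 -> measure_support mu x -> affine_hyperplane L -> 0 < eps ->
    (mu (ball x rho `&` thickening L (eps * rho)) <=
       (Cd * eps `^ alpha)%:E * mu (ball x rho))%E) ->
  (forall (x : 'rV[R]_d.-1) (rho : R),
    measure_support mu x -> 0 < rho <= rho0 ->
    ((C^-1 * rho `^ delta)%:E <= mu (ball x rho))%E /\
    (mu (ball x rho) <= (C * rho `^ delta)%:E)%E) ->
  local_chart U M psi -> measure_support mu u0 -> U u0 ->
  1 <= c -> c < c1 -> 0 < s -> delta - alpha * (1 - 1 / c) < s ->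
  exists2 r, 0 < r & hausdorff_measure s (psi @` ([set u | measure_support mu u /\
    forall N : nat, exists p q, [/\ (N <= q)%N, (0 < q)%N,
      zero_locus P (rational_point R p q) &
      `|psi u - rational_point R p q| <= q%:R `^ (- c1)]] `&` ball u0 r)) = 0%E.
Proof.
move=> qP irrP rho00 Cd0 C1 decay regular chart su0 Uu0 c_ge1 cc1 s0 sbig.
have [r1 [L [K [kap [r10 L0 K0 kap0 [lip fl]]]]]] := chart_flat qP irrP chart Uu0.
have c0 : 0 < c by apply: lt_le_trans c_ge1.
pose r2 := Num.min r1 (rho0 / 2).
have r20 : 0 < r2 by rewrite lt_min r10 divr_gt0.
have r2r : 2 * r2 <= rho0 by rewrite mulrC -ler_pdivlMr// ge_min lexx orbT.
have r21 u : ball u0 r2 u -> ball u0 r1 u by apply: le_ball; rewrite ge_min lexx.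
have [A A0 HA] := scale_cover Cd0 C1 decay regular c_ge1 K0 r20 r2r.
exists r2 => //.
(* With [rho n = y^n] one has [(rho n)^c = 2^(-n c1)], the approximation error at height [2^n].
   Since [c1 / c > 1], the product of [rho n] and [Q n = 2^(n+1)] tends to 0. *)
pose y : R := 2 `^ (- (c1 / c)).
have b1 : 1 < c1 / c by rewrite ltr_pdivlMr// mul1r.
have y0 : 0 < y by rewrite powR_gt0.
have y1 : y < 1 by apply: two_powRN_lt1; apply: lt_trans b1.
(* This is [c] times the gap between [s] and the claimed bound: the exponent of [rho] left after
   multiplying the number of balls by [(rho^c)^s]. *)
pose eta := (c - 1) * alpha - c * delta + c * s.
have eta0 : 0 < eta.
  have : c * (delta - alpha * (1 - 1 / c)) < c * s by rewrite ltr_pM2l.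
  have -> : c * (delta - alpha * (1 - 1 / c)) = c * delta - (c - 1) * alpha.
    by field; rewrite gt_eqF.
  by rewrite /eta; lra.
pose rho n : R := y ^+ n.
have rho_gt0 n : 0 < rho n by rewrite exprn_gt0.
have rho_le1 n : rho n <= 1 by rewrite exprn_ile1// ltW.
have rhoE n : rho n = 2 `^ (- (c1 / c) * n%:R).
  by rewrite /rho -powR_mulrn ?(ltW y0)// /y -powRrM.
have tauE n : rho n `^ c = (2 ^+ n) `^ (- c1).
  rewrite rhoE -powR_mulrn// -!powRrM; congr (_ `^ _).
  by field; rewrite gt_eqF.
have tau_gt0 n : 0 < rho n `^ c by rewrite powR_gt0.
pose Q n : R := 2 ^+ n.+1.
pose E n := [set u | [/\ measure_support mu u, ball u0 r2 u &
  near_rational P psi (Q n) (rho n `^ c) u]].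
pose x := y `^ eta.
have x01 : 0 <= x < 1.
  rewrite powR_ge0 /x /y -powRrM mulNr two_powRN_lt1// mulr_gt0//.
  exact: lt_trans b1.
apply: (@hausdorff_null_limsup R d s _ (fun n => psi @` E n) (A * (2 * L) `^ s) x) => //.
- by rewrite mulr_ge0// powR_ge0.
- move=> N _ [u [[su Hu] ub] <-].
  have [p [q [Nq q0 Zq hq]]] := Hu (2 ^ N)%N.
  (* The denominator lies in the block [2^m <= q < 2^(m+1)], and [q >= 2^N] forces [m >= N], so
     block [m] belongs to the tail. *)
  have /andP[lo hi] := trunc_log_bounds (isT : (1 < 2)%N) q0.
  set m := trunc_log 2 q in lo hi.
  have Nm : (N <= m)%N by apply: trunc_log_max.
  exists (m - N)%N => //; rewrite subnKC//; exists u => //; split => //.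
  exists p, q; split => //.
    by rewrite /Q -natrX ler_nat ltnW.
  apply: le_trans hq _; rewrite tauE !powRN lef_pV2 ?posrE ?powR_gt0 ?ltr0n//.
  apply: ge0_ler_powR; rewrite ?nnegrE//.
    by apply: ltW; apply: lt_trans cc1.
  by rewrite -natrX ler_nat.
move=> eps eps0.
(* [N1] and [N2] secure the size conditions on [rho n] and [rho n * Q n]; [N3] makes the covering
   sets of diameter at most [eps]. *)
have [N1 HN1] := @expr_small y (Num.min kap r2) (introT andP (conj (ltW y0) y1)) ltac:(by rewrite lt_min kap0).
have y2 : 0 <= 2 * y < 1.
  rewrite mulr_ge0 ?(ltW y0)//= /y -{1}(powRr1 (a := 2))// -powRD; last by rewrite pnatr_eq0 implybT.
  have -> : 1 - c1 / c = - (c1 / c - 1) by ring.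
  by rewrite two_powRN_lt1// subr_gt0.
have [N2 HN2] := @expr_small (2 * y) (kap / 2) y2 ltac:(by rewrite divr_gt0).
have yc : 0 <= y `^ c < 1.
  rewrite powR_ge0 /y -powRrM mulNr two_powRN_lt1// mulr_gt0//.
  exact: lt_trans b1.
have [N3 HN3] := @expr_small (y `^ c) (eps / (2 * L)) yc ltac:(by rewrite divr_gt0// mulr_gt0).
exists (maxn N1 (maxn N2 N3)) => n; rewrite !geq_max => /and3P[n1 n2 n3].
have /andP[rk rr2] : (rho n <= kap) && (rho n <= r2) by rewrite -le_min; exact: HN1.
have rQ : rho n * Q n <= kap.
  have := HN2 n n2; rewrite exprMn ler_pdivlMr// => h.
  by apply: le_trans h; rewrite /rho /Q exprS; rewrite le_eqVlt; apply/orP; left; apply/eqP; ring.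
have tau_eps : 2 * L * rho n `^ c <= eps.
  have := HN3 n n3; rewrite ler_pdivlMr ?mulr_gt0// mulrC => h.
  apply: le_trans h; rewrite /rho -!powR_mulrn ?powR_ge0 ?(ltW y0)// -!powRrM.
  by rewrite (mulrC c).
have [||||l [lE lc ls]] := HA (E n) u0 (rho n) _ su0 _ _ (rho_le1 n).
- by move=> u [].
- by move=> u [].
- by rewrite rho_gt0.
- move=> r /andP[tr rr].
  have r_gt0 : 0 < r by apply: lt_le_trans tr.
  apply: (fl (E n) (Q n)).
  + by move=> u [_ /r21].
  + by move=> u [].
  + by rewrite tr powR_ge0.
  + by rewrite r_gt0 (le_trans rr).
  + by apply: le_trans rQ; rewrite ler_wpM2r// exprn_ge0.
pose F z := psi @` (E n `&` ball z (rho n `^ c)).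
have tau2 : 0 <= 2 * L * rho n `^ c <= eps.
  by rewrite tau_eps andbT !mulr_ge0 ?powR_ge0// ltW.
have := @hausdorff_premeasure_seq R d s eps _ (psi @` E n) (map F l) s0 tau2.
move=> /(_ _ _)/le_trans; apply.
- move=> _ [u Eu <-]; have [z zl zu] := lc u Eu.
  by exists (F z); [exact: map_f|exists u].
- move=> _ /mapP[z zl ->]; apply: diameter_le; first by case/andP: tau2.
  move=> _ _ [u [Eu zu] <-] [v [Ev zv] <-].
  have [_ /r21 ub _] := Eu; have [_ /r21 vb _] := Ev.
  apply: le_trans (lip _ _ ub vb) _; rewrite (mulrC 2 L) -mulrA ler_pM2l//.
  move: zu zv; rewrite -!ball_normE /= => zu zv.
  have := ler_distD z u v; rewrite (distrC u z) => h; apply: (le_trans h); lra.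
rewrite lee_fin size_map.
apply: le_trans (ler_wpM2r _ ls) _; first exact: powR_ge0.
rewrite le_eqVlt; apply/orP; left; apply/eqP.
have -> : (2 * L * rho n `^ c) `^ s = (2 * L) `^ s * rho n `^ (c * s).
  by rewrite powRM ?mulr_ge0 ?powR_ge0 ?(ltW L0)// -powRrM.
have -> : x ^+ n = rho n `^ eta.
  by rewrite /x /rho -!powR_mulrn ?powR_ge0 ?(ltW y0)// -!powRrM (mulrC eta).
rewrite /eta [in RHS]powRD; last by rewrite (gt_eqF (rho_gt0 n)) implybT.
by ring.
Qed.

End LocalNull.

Theorem theorem1p2 (R : realType) (d : nat) (hd : (2 <= d)%N)
    (P : mpoly d int) (hP : quadratic P) (hPirr : irreducible_over_rat P)
    (alpha delta : R)
    (mu : {measure set borel_row R d.-1 -> \bar R})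
    (hmu0 : mu setT <> 0%E) (hmufin : locally_finite mu)
    (hfriendly : absolutely_friendly alpha mu)
    (hregular : ahlfors_regular delta mu)
    (U : set 'rV[R]_d.-1) (hU : open U) (hsupp : measure_support mu `<=` U)
    (psi : 'rV[R]_d.-1 -> 'rV[R]_d)
    (hpsi : local_chart U (regular_locus P) psi)
    (c : R) (hc : 1 <= c) :
  (hausdorff_dim
     (very_well_approx c (zero_locus P) `&`
      support_in (psi @` U) (chart_pushforward mu U psi))
   <= (delta - alpha * (1 - 1 / c))%:E)%E.
Proof.
have [[alpha0 [rd [Cd [rd0 Cd0 decay]]]] _] := hfriendly.
have [ra [C [ra0 C1 regular]]] := hregular.
pose rho0 := Num.min rd ra.
have rho00 : 0 < rho0 by rewrite lt_min rd0.
have decay' (rho : R) (x : 'rV[R]_d.-1) (L : set 'rV[R]_d.-1) (eps : R) :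
    0 < rho <= rho0 -> measure_support mu x -> affine_hyperplane L -> 0 < eps ->
    (mu (ball x rho `&` thickening L (eps * rho)) <=
       (Cd * eps `^ alpha)%:E * mu (ball x rho))%E.
  move=> /andP[rho_gt0 rho_le]; apply: decay; rewrite rho_gt0/=.
  by apply: le_trans rho_le _; rewrite ge_min lexx.
have regular' (x : 'rV[R]_d.-1) (rho : R) : measure_support mu x -> 0 < rho <= rho0 ->
    ((C^-1 * rho `^ delta)%:E <= mu (ball x rho))%E /\
    (mu (ball x rho) <= (C * rho `^ delta)%:E)%E.
  move=> xs /andP[rho_gt0 rho_le]; apply: regular => //; rewrite rho_gt0/=.
  by apply: le_trans rho_le _; rewrite ge_min lexx orbT.
have [u0 su0] := support_neq0 hmu0.
(* As [d >= 2], the parameter space contains a hyperplane, which the comparison of [alpha] with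
   [delta] uses. *)
have k0 : (0 < d.-1)%N by case: (d) hd => [|[]].
have ad := alpha_le_delta rho00 Cd0 C1 decay' regular' k0 alpha0 su0.
have c0 : 0 < c by apply: lt_le_trans hc.
have b0 : 0 <= delta - alpha * (1 - 1 / c).
  rewrite subr_ge0; apply: le_trans ad; rewrite ler_piMr ?(ltW alpha0)//.
  by rewrite gerBl divr_ge0// ltW.
apply: hausdorff_dim_le => // s sb.
have s0 : 0 < s by apply: le_lt_trans sb.
(* One set for each exponent [c + 1/(j+1)], so that [c] is exceeded by a fixed amount on each. *)
pose X (j : nat) : set 'rV[R]_d.-1 := [set u | measure_support mu u /\
    forall N : nat, exists p q, [/\ (N <= q)%N, (0 < q)%N,
      zero_locus P (rational_point R p q) &
      `|psi u - rational_point R p q| <= q%:R `^ (- (c + j.+1%:R^-1))]].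
apply: (@hausdorff_null_subset _ _ _ _ (\bigcup_j (psi @` X j))).
  move=> z [[_ omz] /(chart_support hpsi)[u su uz]].
  have [j Hj] := omega_gt_approx (ltW c0) omz.
  by exists j => //; exists u => //; split => // N; rewrite uz.
apply: hausdorff_null_bigcup => j.
(* Sets with null image under [psi] form a sigma-ideal, so it suffices to work near each point of
   [X j]. *)
apply: (@sigma_ideal_local R d.-1 (fun A => hausdorff_measure s (psi @` A) = 0%E)).
- rewrite image_set0; apply: hausdorff_nullP => eps eps0; apply/eqP.
  rewrite eq_le hausdorff_premeasure_ge0 andbT.
  have := @hausdorff_premeasure_seq R d s eps 0 set0 [::] s0.
  by rewrite lexx (ltW eps0) mul0r; apply.
- by move=> A B AB; apply: hausdorff_null_subset; exact: image_subset.
- by move=> F HF; rewrite image_bigcup; exact: hausdorff_null_bigcup.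
move=> u Xu; have cj : c < c + j.+1%:R^-1 by rewrite ltrDl invr_gt0 ltr0n.
exact: (local_null hP hPirr rho00 Cd0 C1 decay' regular' hpsi Xu.1 (hsupp _ Xu.1) hc cj s0 sb).
Qed.
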